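(* Let $\mathcal{C}$ be a finite abstract simplicial complex and $\mathcal{M}$ a matroid on the same finite ground set $V$, let $1\le k\le r(\mathcal{M})$ be an integer, and let $\eta\in\{\eta_\pi,\eta_H\}$. If $\eta(\mathcal{C}[X])+r(\mathcal{M}[V\setminus X])\ge k+1$ for all $X\subseteq V$ for which $V\setminus X$ is a flat of $\mathcal{M}$ of rank at most $k-1$, then $\mathbf{RG}(\mathcal{C},\mathcal{M};k)$ is connected.
   Context: $\mathcal{C}[X]=\{\sigma\in\mathcal{C}:\sigma\subseteq X\}$, $\mathcal{M}[X]=\{A\in\mathcal{M}:A\subseteq X\}$, and $r$ denotes matroid rank. A flat of $\mathcal{M}$ is $F\subseteq V$ with $r(\mathcal{M}[F\cup\{x\}])>r(\mathcal{M}[F])$ for all $x\in V\setminus F$. $\eta_\pi(\mathcal{K})$ (resp. $\eta_H(\mathcal{K})$) is $2$ plus the largest $k\ge-2$ such that $\mathcal{K}$ is homotopically $j$-connected (resp. $\widetilde H_j(\mathcal{K};\mathbb{Q})=0$) for all $-1\le j\le k$, where $(-1)$-connectedness / $\widetilde H_{-1}=0$ means $\mathcal{K}$ has at least one vertex; the value may be $\infty$. $\mathbf{RG}(\mathcal{C},\mathcal{M};k)$ is the graph whose vertices are the independent sets of $\mathcal{M}$ of size $k$ that are simplices of $\mathcal{C}$, two being adjacent if their union is a simplex of $\mathcal{C}$ of cardinality $k+1$. *)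

(* Defs.v *)
From HB Require Import structures.
From mathcomp Require Import all_boot all_order all_algebra.
From mathcomp Require Import all_classical all_reals all_analysis.
Set Implicit Arguments. Unset Strict Implicit. Unset Printing Implicit Defensive.
Import Order.TTheory GRing.Theory Num.Theory.
Import numFieldNormedType.Exports.
Local Open Scope ring_scope.

Definition sc_is_complex (n : nat) (C : {set {set 'I_n}}) : Prop :=
  forall s t : {set 'I_n}, s \in C -> t \subset s -> t \in C.

Definition sc_induced (n : nat) (C : {set {set 'I_n}}) (X : {set 'I_n}) :
  {set {set 'I_n}} := [set s in C | s \subset X].

Definition sc_is_matroid (n : nat) (M : {set {set 'I_n}}) : Prop :=
  [/\ finset.set0 \in M,
      (forall A B : {set 'I_n}, A \in M -> B \subset A -> B \in M) &
      (forall A B : {set 'I_n}, A \in M -> B \in M -> #|A| < #|B| ->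
          exists2 x, x \in B :\: A & x |: A \in M)]%N.

Definition sc_mrestr (n : nat) (M : {set {set 'I_n}}) (X : {set 'I_n}) :
  {set {set 'I_n}} := [set A in M | A \subset X].

Definition sc_mrank (n : nat) (M : {set {set 'I_n}}) : nat := (\max_(A in M) #|A|)%N.

Definition sc_is_flat (n : nat) (M : {set {set 'I_n}}) (F : {set 'I_n}) : Prop :=
  forall x : 'I_n, x \notin F ->
    (sc_mrank (sc_mrestr M F) < sc_mrank (sc_mrestr M (x |: F)))%N.

Definition sc_realization (R : realType) (n : nat) (C : {set {set 'I_n}}) :
  set 'rV[R]_n :=
  fun x => (forall i, 0 <= x ord0 i) /\ \sum_i x ord0 i = 1 /\
           [set i | x ord0 i != 0] \in C.

Arguments sc_realization R {n} C.

(** Unit sphere S^(m-1) and unit ball D^m in R^m (Euclidean). For m = 0 the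
    sphere is empty and the ball is a point. *)
Definition sc_usphere (R : realType) (m : nat) : set 'rV[R]_m :=
  fun x => \sum_i x ord0 i ^+ 2 = 1.
Definition sc_udisk (R : realType) (m : nat) : set 'rV[R]_m :=
  fun x => \sum_i x ord0 i ^+ 2 <= 1.

Arguments sc_usphere R m : clear implicits.
Arguments sc_udisk R m : clear implicits.

(** [sc_conn_pi R C m] : |C| is homotopically (m-1)-connected at level m-1, i.e.
    every continuous map S^(m-1) -> |C| extends to a continuous map
    D^m -> |C|.  For m = 0 this says exactly that |C| is nonempty,
    i.e. C has a vertex ((-1)-connectedness). *)
Definition sc_conn_pi (R : realType) (n : nat) (C : {set {set 'I_n}}) (m : nat) : Prop :=
  forall f : 'rV[R]_m -> 'rV[R]_n,
    {within sc_usphere R m, continuous f}%classic ->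
    (f @` sc_usphere R m `<=` sc_realization R C)%classic ->
    exists g : 'rV[R]_m -> 'rV[R]_n,
      [/\ {within sc_udisk R m, continuous g}%classic,
          (g @` sc_udisk R m `<=` sc_realization R C)%classic &
          forall x, sc_usphere R m x -> g x = f x].

(** Chains of faces of size m (dimension m-1) of C, with coefficients in Q.
    Chains are functions on all subsets, supported on the faces of size m.
    The size-0 slot is the augmentation group Q (always present). *)
Definition sc_chain_on (n : nat) (C : {set {set 'I_n}}) (m : nat)
  (c : {ffun {set 'I_n} -> rat}) : Prop :=
  forall s, c s != 0 -> (s \in C) && (#|s| == m)%N.

(** Incidence sign [s : t] for t = s minus one vertex v: (-1)^(position of v in s). *)
Definition sc_isign (n : nat) (s t : {set 'I_n}) : rat :=
  (-1) ^+ (\sum_(v in s :\: t) #|[set u in s | (u < v)%N]|)%N.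

(** Boundary: (sc_bd c)(t) = sum over s with t ⊂ s, |s| = |t|+1 of [s:t] c(s).
    On size-1 chains this is the augmentation. *)
Definition sc_bd (n : nat) (c : {ffun {set 'I_n} -> rat}) (t : {set 'I_n}) : rat :=
  \sum_(s : {set 'I_n} | (t \subset s) && (#|s| == #|t|.+1)%N) sc_isign s t * c s.

(** [sc_conn_H C m] : reduced rational homology in degree m-1 vanishes;
    for m = 0 this is the convention "C has at least one vertex". *)
Definition sc_conn_H (n : nat) (C : {set {set 'I_n}}) (m : nat) : Prop :=
  match m with
  | 0 => exists v : 'I_n, [set v] \in C
  | m'.+1 => forall c, sc_chain_on C m c -> (forall t, sc_bd c t = 0) ->
             exists2 d, sc_chain_on C m.+1 d & forall s, sc_bd d s = c s
  end.

(** eta from a connectivity sequence: eta = 2 + the largest k >= -2 such that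
    conn(j+1) holds for all -1 <= j <= k; equivalently the least m with
    ~ conn m, or infinity (None) if there is none. *)
Lemma sc_eta_of_ex (c : nat -> Prop) :
  (exists m, ~ c m) -> exists m, (fun m => ~~ `[< c m >]) m.
Proof. by case=> m hm; exists m; apply/negP => /asboolP. Qed.

Definition sc_eta_of (c : nat -> Prop) : option nat :=
  match pselect (exists m, ~ c m) with
  | left H => Some (ex_minn (sc_eta_of_ex H))
  | right _ => None
  end.

Inductive sc_eta_kind := sc_EtaPi | sc_EtaH.

Definition sc_eta (R : realType) (e : sc_eta_kind) (n : nat) (C : {set {set 'I_n}}) :
  option nat :=
  match e with
  | sc_EtaPi => sc_eta_of (sc_conn_pi R C)
  | sc_EtaH => sc_eta_of (sc_conn_H C)
  end.

(** [sc_xadd_ge a b t] : a + b >= t, where a = None stands for infinity. *)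
Definition sc_xadd_ge (a : option nat) (b t : nat) : Prop :=
  if a is Some a' then (t <= a' + b)%N else True.

Definition sc_rg_vertex (n : nat) (C M : {set {set 'I_n}}) (k : nat) (A : {set 'I_n}) : bool :=
  [&& A \in M, A \in C & #|A| == k]%N.
Definition sc_rg_edge (n : nat) (C M : {set {set 'I_n}}) (k : nat) : rel {set 'I_n} :=
  fun A B => [&& sc_rg_vertex C M k A, sc_rg_vertex C M k B,
                 A :|: B \in C & #|A :|: B| == k.+1]%N.

Definition sc_rg_connected (n : nat) (C M : {set {set 'I_n}}) (k : nat) : Prop :=
  (exists A, sc_rg_vertex C M k A) /\
  forall A B, sc_rg_vertex C M k A -> sc_rg_vertex C M k B -> connect (sc_rg_edge C M k) A B.

(* Main.v *)
(* Let f be a chain map from the order complex of the flats of rank < k to the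
   chains of C, sending a flag F_0 < ... < F_j to a j-chain of C[V \ F_0].  The
   hypothesis on eta provides such an f, and makes any two of them chain
   homotopic through chains D(F_0 < ... < F_j) of dimension j + 1 in C[V \ F_0].
   For a set S of k-element independent simplices closed under adjacency in
   RG(C, M; k), consider the localized Lefschetz number

     t_S(f) = sum over ordered members c = (c_1, ..., c_k) of S of the
              coefficient of c in f(cl {} < cl {c_1} < ... < cl {c_1, ..., c_(k-1)}).

   It is a homotopy invariant: replacing f by f + bd D + D bd changes it by two
   sums that vanish through sign-reversing involutions.  In the first, a vertex v
   is exchanged with the c_i at which v enters the closures of the prefixes of c;
   in the second, c_i is exchanged with c_(i+1), the term of the face omitting
   F_0 being killed by the carrier condition.  For a vertex A of RG, the map f_A
   sending F to the first element of A outside F has t_S(f_A) > 0 if A is in S and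
   t_S(f_A) = 0 otherwise.  Taking for S a connected component gives
   connectedness; comparing, inside the full simplex, an f with values in C to
   f_A for an independent set A of size k gives nonemptiness.

   For eta_pi, only the vanishing of rational homology below the connectivity is
   needed.  If K is connected enough, extend the identity of |K| to a map r from a
   skeleton of the full simplex to |K|.  On a fine iterated barycentric
   subdivision, label a point x by a vertex v with r(x)_v >= 1/n; close points get
   labels spanning a simplex of K, so the labels turn a cone over a cycle of K,
   subdivided, into a chain of K bounded by that cycle. *)

Require Import Defs.
From HB Require Import structures.
From mathcomp Require Import all_boot all_order all_algebra.
From mathcomp Require Import all_classical all_reals all_analysis.
From mathcomp Require Import ring lra zify.

Set Implicit Arguments. Unset Strict Implicit. Unset Printing Implicit Defensive.

(** * Chains of faces *)

Section FaceSums.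
Import GRing.Theory.
Local Open Scope ring_scope.
Variables (X : eqType) (W : zmodType).
Implicit Types (l m : seq X) (G H : seq X -> W).

(* The alternating sum of [G] over the lists obtained from [l] by deleting one
   entry; [dsum [:: x] G = G [::]]. *)
Fixpoint dsum l G : W :=
  if l is x :: l' then G l' - dsum l' (fun m => G (x :: m)) else 0.

Lemma dsum_closed (P : W -> Prop) l G :
  P 0 -> (forall a b, P a -> P b -> P (a - b)) ->
  (forall m, subseq m l -> (size m).+1 = size l -> P (G m)) -> P (dsum l G).
Proof.
move=> P0 PB; elim: l G => [//|x l IHl] G PG /=; apply: PB.
  by apply: PG => //; apply: subseq_cons.
apply: IHl => m ml sm; apply: PG; last by rewrite /= sm.
by rewrite /= eqxx.
Qed.

Lemma eq_dsum l G H :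
  (forall m, subseq m l -> (size m).+1 = size l -> G m = H m) ->
  dsum l G = dsum l H.
Proof.
elim: l G H => [//|x l IHl] G H GH /=.
rewrite (GH l) ?subseq_cons//; congr (_ - _); apply: IHl => m ml sm.
by apply: GH => /=; rewrite ?eqxx // sm.
Qed.

Lemma dsumB l G H : dsum l (fun m => G m - H m) = dsum l G - dsum l H.
Proof.
elim: l G H => [|x l IHl] G H /=; first by rewrite subrr.
by rewrite IHl !opprB addrACA [RHS]addrACA; congr (_ + _); rewrite addrC.
Qed.

Lemma dsum0 l : dsum l (fun=> 0) = 0.
Proof. by elim: l => //= x l ->; rewrite subrr. Qed.

Lemma dsumN l G : dsum l (fun m => - G m) = - dsum l G.
Proof.
rewrite -[RHS]sub0r -[X in X - _](dsum0 l) -dsumB; apply: eq_dsum => m _ _.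
by rewrite sub0r.
Qed.

(** The identity bd bd = 0 in combinatorial form: the two orders of deleting a given pair of entries
    carry opposite signs. *)
Lemma dsumK l G : dsum l (fun m => dsum m G) = 0.
Proof.
elim: l G => [//|x l IHl] G /=.
by rewrite dsumB opprB addrCA subrr addr0 IHl.
Qed.

Lemma dsumE l G : dsum l G =
  \sum_(i < size l) (if odd i then - G (take i l ++ drop i.+1 l)
                     else G (take i l ++ drop i.+1 l)).
Proof.
elim: l G => [|x l IHl] G; first by rewrite big_ord0.
rewrite big_ord_recl /= drop0; congr (_ + _).
rewrite IHl -sumrN; apply: eq_bigr => i _ /=.
by case: (odd i); rewrite /= ?opprK.
Qed.

End FaceSums.

Lemma raddf_dsum (X : eqType) (V W : zmodType) (f : {additive V -> W})
  (l : seq X) (G : seq X -> V) : f (dsum l G) = dsum l (fun m => f (G m)).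
Proof.
by elim: l G => [|x l IHl] G /=; rewrite ?GRing.raddf0 // GRing.raddfB IHl.
Qed.

Lemma dsum_map (X Y : eqType) (W : zmodType) (f : X -> Y) (l : seq X)
  (G : seq Y -> W) : dsum (map f l) G = dsum l (fun m => G (map f m)).
Proof. by elim: l G => [//|x l IHl] G /=; rewrite IHl. Qed.

(** Reindexing by [phi] turns the sum into its own negative. Fixed points are harmless, as [F]
    vanishes there. *)
Lemma sum_signed_involution (I : finType) (P : pred I) (F : I -> rat)
    (phi : I -> I) :
  (forall p, P p -> [/\ P (phi p), phi (phi p) = p & F (phi p) = - F p]%R) ->
  (\sum_(p | P p) F p = 0)%R.
Proof.
move=> phiP; set s := (\sum_(p | _) _)%R.
suff : (s = - s)%R by lra.
rewrite {1}/s (reindex_onto phi phi); last by move=> p /phiP[].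
rewrite -GRing.sumrN; apply: congr_big => // p.
  apply/andP/idP => [[Pp /eqP <-]|Pp]; first by case: (phiP _ Pp).
  by case: (phiP _ Pp) => -> ->.
move=> /andP[Pp /eqP pE]; have [_ _] := phiP _ Pp.
by rewrite pE => ->; rewrite GRing.opprK.
Qed.

Section Chains.
Import mathcomp.boot.fintype mathcomp.boot.finset GRing.Theory Num.Theory.
Local Open Scope ring_scope.
Variable n : nat.
Implicit Types (v w : 'I_n) (s t : {set 'I_n}) (l m : seq 'I_n).
Notation chain := {ffun {set 'I_n} -> rat}.
Implicit Types (c x y : chain).

Definition below v s : nat := #|[set u in s | (u < v)%N]|.

Lemma below_setU1 v w s : v != w -> w \notin s ->
  below v (w |: s) = ((w < v) + below v s)%N.
Proof.
move=> vw ws; rewrite /below.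
have [wv|wv] := boolP (w < v)%N.
  have -> : [set u in w |: s | (u < v)%N] = w |: [set u in s | (u < v)%N].
    apply/setP => u; rewrite !inE; case: eqVneq => [->|//]; by rewrite wv.
  by rewrite cardsU1 !inE (negbTE ws).
congr #|pred_of_set _|; apply/setP => u; rewrite !inE.
by case: eqVneq => [->|//]; rewrite (negbTE wv) !andbF.
Qed.

Lemma below_setD1 v s : below v (s :\ v) = below v s.
Proof.
congr #|pred_of_set _|; apply/setP => u; rewrite !inE.
by case: eqVneq => [->|//]; rewrite ltnn !andbF.
Qed.

(* Interior and exterior multiplication by [v]; they satisfy the canonical
   anticommutation relations [contr_anti] and [contr_wedge]. *)
Definition contr v x : chain :=
  [ffun t : {set 'I_n} => if v \in t then 0 else (-1) ^+ below v t * x (v |: t)].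

Definition wedge v x : chain :=
  [ffun s : {set 'I_n} => if v \in s then (-1) ^+ below v s * x (s :\ v) else 0].

Definition bd x : chain := \sum_v contr v x.

Fact contr_is_zmod_morphism v : zmod_morphism (contr v).
Proof.
move=> x y; apply/ffunP => t; rewrite !ffunE.
by case: ifP => _; rewrite ?subrr // mulrBr.
Qed.
HB.instance Definition _ v :=
  GRing.isZmodMorphism.Build chain chain (contr v) (contr_is_zmod_morphism v).

Fact wedge_is_zmod_morphism v : zmod_morphism (wedge v).
Proof.
move=> x y; apply/ffunP => t; rewrite !ffunE.
by case: ifP => _; rewrite ?subrr // mulrBr.
Qed.
HB.instance Definition _ v :=
  GRing.isZmodMorphism.Build chain chain (wedge v) (wedge_is_zmod_morphism v).

Fact bd_is_zmod_morphism : zmod_morphism bd.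
Proof.
move=> x y; rewrite /bd -sumrB; apply: eq_bigr => v _; exact: raddfB.
Qed.
HB.instance Definition _ :=
  GRing.isZmodMorphism.Build chain chain bd bd_is_zmod_morphism.

Definition scal (q : rat) x : chain := [ffun s => q * x s].

Fact scal_is_zmod_morphism q : zmod_morphism (scal q).
Proof. by move=> x y; apply/ffunP => s; rewrite !ffunE mulrBr. Qed.
HB.instance Definition _ q :=
  GRing.isZmodMorphism.Build chain chain (scal q) (scal_is_zmod_morphism q).

Definition scalr x q := scal q x.

Fact scalr_is_zmod_morphism x : zmod_morphism (scalr x).
Proof. by move=> q q'; apply/ffunP => s; rewrite !ffunE mulrBl. Qed.
HB.instance Definition _ x :=
  GRing.isZmodMorphism.Build rat chain (scalr x) (scalr_is_zmod_morphism x).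

Lemma bd0 : bd 0 = 0. Proof. exact: raddf0. Qed.
Lemma bdN x : bd (- x) = - bd x. Proof. exact: raddfN. Qed.
Lemma bdB x y : bd (x - y) = bd x - bd y. Proof. exact: raddfB. Qed.
Lemma bd_dsum (X : eqType) (s : seq X) (G : seq X -> chain) :
  bd (dsum s G) = dsum s (fun r => bd (G r)).
Proof. exact: raddf_dsum. Qed.

(** The sets [s] in [sc_bd] are the [v |: t] with [v] outside [t], and the sign exponent then
    reduces to the single term [below v t]. *)
Lemma bdE x t : bd x t = sc_bd x t.
Proof.
rewrite /bd sum_ffunE /sc_bd.

have -> : \sum_(s : {set 'I_n} | (t \subset s) && (#|s| == #|t|.+1)%N)
             sc_isign s t * x s =
          \sum_(s in [set v |: t | v in ~: t]) sc_isign s t * x s.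
  apply: eq_bigl => s; apply/andP/imsetP => [[ts /eqP cs]|[v]].
    have /cards1P[v vE] : #|s :\: t| == 1%N.
      by rewrite cardsD (setIidPr ts) cs subSnn.
    exists v; first by rewrite inE; have := set11 v; rewrite -vE inE => /andP[].
    by rewrite -vE setUC -[LHS](setID s t) (setIidPr ts).
  by rewrite inE => vt ->; rewrite subsetUr cardsU1 vt.
rewrite big_imset /=; last first.
  move=> v w; rewrite !inE => vt wt /setP/(_ v).
  by rewrite !inE eqxx (negbTE vt) !orbF => /esym/eqP.
rewrite (bigID (fun v => v \in t)) /= big1 ?add0r; last first.
  by move=> v vt; rewrite ffunE vt.
apply: eq_big => [v|v vt]; first by rewrite inE.
rewrite ffunE (negbTE vt); congr (_ * _).
rewrite /sc_isign (_ : (v |: t) :\: t = [set v]); last first.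
  apply/setP => u; rewrite !inE; case: eqVneq => [->|_]; first by rewrite vt.
  by rewrite /= andNb.
rewrite big_set1; congr (_ ^+ _); apply: eq_card => u; rewrite !inE.
by case: eqVneq => [->|//]; rewrite ltnn !andbF.
Qed.

Lemma contr_anti v w x : contr v (contr w x) = - contr w (contr v x).
Proof.
apply/ffunP => t; rewrite !ffunE !inE.
have [->|vw] := eqVneq v w; first by rewrite ?eqxx /= ?mulr0 ?if_same ?oppr0.
rewrite /=.
have [vt|vt] := boolP (v \in t); first by rewrite mulr0 if_same oppr0.
have [wt|wt] := boolP (w \in t); first by rewrite mulr0 oppr0.
rewrite below_setU1 1?eq_sym // below_setU1 // setUCA !exprD.
have [lt|lt|/val_inj e] := ltngtP v w; rewrite ?expr0 ?expr1.
- by ring.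
- by ring.
- by move: vw; rewrite e eqxx.
Qed.

Lemma below_setU1_id v t : v \notin t -> below v (v |: t) = below v t.
Proof. by move=> vt; rewrite -(below_setD1 v (v |: t)) setU1K. Qed.

Lemma sign_sq (m : nat) (q : rat) : (-1) ^+ m * ((-1) ^+ m * q) = q.
Proof. by rewrite mulrA -expr2 sqrr_sign mul1r. Qed.

Lemma contr_wedge v w x :
  contr v (wedge w x) = (if v == w then x else 0) - wedge w (contr v x).
Proof.
apply/ffunP => t; rewrite [RHS]ffunE [X in _ + X]ffunE.
rewrite [LHS]ffunE [wedge _ _ _ in LHS]ffunE [wedge w _ t]ffunE.
rewrite [contr v x _]ffunE !inE.
have [->|vw] := eqVneq v w.
  rewrite /=; case: (boolP (w \in t)) => wt /=.
    by rewrite below_setD1 setD1K // sign_sq subrr.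
  by rewrite below_setU1_id // setU1K // sign_sq subr0.
rewrite ffunE add0r /=.
have [vt|vt] := boolP (v \in t); first by rewrite mulr0 if_same oppr0.
have [wt|wt] := boolP (w \in t); last by rewrite mulr0 oppr0.
have -> : (v |: t) :\ w = v |: t :\ w.
  by apply/setP => u; rewrite !inE; case: (eqVneq u v) => [->|_] //=; rewrite vw.
rewrite (below_setU1 _ vt) 1?eq_sym //.
rewrite -{1}(setD1K wt) below_setU1 ?inE ?eqxx // !exprD.
have [lt|lt|/val_inj e] := ltngtP v w; rewrite ?expr0 ?expr1.
- by ring.
- by ring.
- by move: vw; rewrite e eqxx.
Qed.

(** Summing [contr_wedge] over the contracted vertex leaves one diagonal term. This is the cone
    formula, with [wedge v] as contracting homotopy. *)
Lemma wedgeB_bd v x : bd (wedge v x) = x - wedge v (bd x).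
Proof.
rewrite /bd raddf_sum /=; under eq_bigr do rewrite contr_wedge.
by rewrite sumrB -big_mkcond big_pred1_eq.
Qed.

Definition emptyc : chain := [ffun s : {set 'I_n} => (s == set0)%:R].

(** The exterior product of the entries. It is 0 when an entry repeats, so degenerate simplices drop
    out by themselves. *)
Definition simp l : chain := foldr wedge emptyc l.

Lemma contr_emptyc v : contr v emptyc = 0.
Proof.
apply/ffunP => t; rewrite !ffunE; case: ifP => // vt.
by rewrite -cards_eq0 cardsU1 vt add1n mulr0.
Qed.

Lemma bd_emptyc : bd emptyc = 0.
Proof. by rewrite /bd big1 // => v _; rewrite contr_emptyc. Qed.

Lemma bd_simp l : bd (simp l) = dsum l simp.
Proof.
elim: l => [|v l IHl] /=; first exact: bd_emptyc.
by rewrite wedgeB_bd IHl raddf_dsum.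
Qed.

Lemma simp_supp l s : simp l s != 0 -> s = [set u in l] /\ #|s| = size l.
Proof.
elim: l s => [|v l IHl] s /=.
  rewrite ffunE pnatr_eq0 eqb0 negbK => /eqP ->; rewrite cards0; split=> //.
rewrite ffunE; case: ifP => [vs|]; last by rewrite eqxx.
rewrite mulf_eq0 negb_or => /andP[_ /IHl[sE <-]].
split; last by rewrite (cardsD1 v) vs.
by rewrite -(setD1K vs) sE; apply/setP => u; rewrite !inE.
Qed.

Lemma simp_uniq l s : simp l s != 0 -> uniq l.
Proof.
case/simp_supp => -> /esym e; apply/card_uniqP; rewrite e.
by apply: eq_card => u; rewrite inE.
Qed.

(* The coefficient of the oriented simplex [simp l] in [x]. *)
Fixpoint ev x l : rat := if l is v :: l' then ev (contr v x) l' else x set0.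

Definition evl l x := ev x l.

Fact evl_is_zmod_morphism l : zmod_morphism (evl l).
Proof.
rewrite /evl; elim: l => [|v l IHl] x y /=; first by rewrite !ffunE.
by rewrite raddfB IHl.
Qed.
HB.instance Definition _ l :=
  GRing.isZmodMorphism.Build chain rat (evl l) (evl_is_zmod_morphism l).

Lemma evN x l : ev (- x) l = - ev x l. Proof. exact: (raddfN (evl l)). Qed.
Lemma evB x y l : ev (x - y) l = ev x l - ev y l.
Proof. exact: (raddfB (evl l)). Qed.

Lemma ev_bd x l : ev (bd x) l = \sum_v ev x (v :: l).
Proof. exact: (raddf_sum (evl l)). Qed.

Lemma ev_swap l1 v w l2 x :
  ev x (l1 ++ v :: w :: l2) = - ev x (l1 ++ w :: v :: l2).
Proof.
elim: l1 x => [|u l1 IHl] x /=; last exact: IHl.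
by rewrite contr_anti evN.
Qed.

Lemma ev_swap_head v l1 w l2 x :
  ev x (v :: l1 ++ w :: l2) = - ev x (w :: l1 ++ v :: l2).
Proof.
elim: l1 x => [|u l1 IHl] x; first exact: (ev_swap [::]).
rewrite !cat_cons (ev_swap [::] v u) (ev_swap [::] w u) /= opprK.
by have /= -> := IHl (contr u x); rewrite opprK.
Qed.

Lemma ev_neq0 x l : ev x l != 0 -> uniq l /\ x [set u in l] != 0.
Proof.
elim: l x => [|v l IHl] x /=.
  by move=> x0; split=> //; rewrite (_ : [set u in [::]] = set0) //;
     apply/setP => u; rewrite !inE.
case/IHl => ul; rewrite ffunE inE.
case: ifP => [_|vl]; first by rewrite eqxx.
rewrite mulf_eq0 negb_or => /andP[_ xl]; split; first by rewrite ul.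
have -> // : [set u in v :: l] = v |: [set u in l].
by apply/setP => u; rewrite !inE.
Qed.

Lemma contr_simp v l : v \notin l -> contr v (simp l) = 0.
Proof.
elim: l => [|w l IHl] /=; first by rewrite contr_emptyc.
rewrite inE negb_or => /andP[vw vl]; rewrite contr_wedge (negbTE vw).
by rewrite IHl // raddf0 subrr.
Qed.

Lemma ev_simp l : uniq l -> ev (simp l) l = 1.
Proof.
elim: l => [|v l IHl] /=; first by rewrite ffunE eqxx.
case/andP => vl ul; rewrite contr_wedge eqxx contr_simp // raddf0 subr0.
exact: IHl.
Qed.

(** [p] counts vertices, so the homology concerned has degree p - 1. At p = 0 this is exactness at
    the augmentation instead of existence of a vertex. *)
Definition acyc (K : {set {set 'I_n}}) (p : nat) : Prop :=
  forall c, sc_chain_on K p c -> bd c = 0 ->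
    exists2 d, sc_chain_on K p.+1 d & bd d = c.

Lemma conn_H_acyc K p : sc_is_complex K -> sc_conn_H K p -> acyc K p.
Proof.
move=> cK; case: p => [[v vK]|p] /=.
  (* At p = 0 the chain is a multiple of the empty simplex, and coning it from the vertex [v]
     suffices. *)
  move=> c cc bc; exists (wedge v c).
    move=> s; rewrite ffunE; case: ifP => [vs|_]; last by rewrite eqxx.
    rewrite mulf_eq0 negb_or => /andP[_ /cc/andP[_ s0]].
    have -> : s = [set v].
      by rewrite -(setD1K vs); move: s0; rewrite cards_eq0 => /eqP ->; rewrite setU0.
    by rewrite vK cards1.
  by rewrite wedgeB_bd bc raddf0 subr0.
move=> H c cc bc; have [|d dd de] := H c cc.
  by move=> t; rewrite -bdE bc ffunE.
by exists d => //; apply/ffunP => s; rewrite bdE.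
Qed.

Lemma chain_onS (K L : {set {set 'I_n}}) p c :
  K \subset L -> sc_chain_on K p c -> sc_chain_on L p c.
Proof. by move=> /subsetP KL cc s /cc/andP[/KL -> ->]. Qed.

Lemma chain_on0 (K : {set {set 'I_n}}) p : sc_chain_on K p 0.
Proof. by move=> s; rewrite ffunE eqxx. Qed.

Lemma chain_onB (K : {set {set 'I_n}}) p c d :
  sc_chain_on K p c -> sc_chain_on K p d -> sc_chain_on K p (c - d).
Proof.
move=> cc cd s; have [/cc//|] := boolP (c s != 0).
rewrite negbK => /eqP c0; have [/cd//|] := boolP (d s != 0).
by rewrite negbK => /eqP d0; rewrite !ffunE c0 d0 subrr eqxx.
Qed.

(** A full simplex is a cone with any of its vertices as apex. *)
Lemma acyc_full (X : {set 'I_n}) p :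
  X != set0 -> acyc (sc_induced setT X) p.
Proof.
case/set0Pn => v vX c cc bc; exists (wedge v c); last first.
  by rewrite wedgeB_bd bc raddf0 subr0.
move=> s; rewrite ffunE; case: ifP => [vs|_]; last by rewrite eqxx.
rewrite mulf_eq0 negb_or => /andP[_ /cc]; rewrite !inE /= => /andP[sX /eqP <-].
by rewrite (cardsD1 v s) vs eqxx andbT -(setD1K vs) subUset sub1set vX.
Qed.

End Chains.

(** * Closure in a matroid *)

Section Matroid.
Import mathcomp.boot.fintype mathcomp.boot.finset.
Variables (n : nat) (M : {set {set 'I_n}}).
Hypothesis matM : sc_is_matroid M.
Implicit Types (X Y A B I J : {set 'I_n}) (l c : seq 'I_n).

Let M0 : set0 \in M. Proof. by case: matM. Qed.
Let MS A B : B \subset A -> A \in M -> B \in M.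
Proof. by case: matM => _ H _ BA AM; apply: H BA. Qed.
Let Maug A B : A \in M -> B \in M -> (#|A| < #|B|)%N ->
  exists2 x, x \in B :\: A & x |: A \in M.
Proof. by case: matM => _ _ H; apply: H. Qed.

Definition rk X : nat := sc_mrank (sc_mrestr M X).

Lemma rk_ge X I : I \in M -> I \subset X -> (#|I| <= rk X)%N.
Proof.
by move=> IM IX; apply: (@leq_bigmax_cond _ _ (fun A => #|A|)); rewrite inE IM.
Qed.

Lemma rk_basis X : exists I, [/\ I \in M, I \subset X & #|I| = rk X].
Proof.
have h : (0 < #|sc_mrestr M X|)%N.
  by apply/card_gt0P; exists set0; rewrite inE M0 sub0set.
have [I] := eq_bigmax_cond (fun A : {set 'I_n} => #|A|) h.
by rewrite inE => /andP[IM IX] e; exists I; split=> //; rewrite -e.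
Qed.

Lemma rkS X Y : X \subset Y -> (rk X <= rk Y)%N.
Proof.
move=> XY; have [I [IM IX <-]] := rk_basis X.
by apply: rk_ge => //; apply: subset_trans XY.
Qed.

Lemma rk_indep I : I \in M -> rk I = #|I|.
Proof.
move=> IM; apply/eqP; rewrite eqn_leq rk_ge // andbT.
by have [J [_ JI <-]] := rk_basis I; apply: subset_leq_card.
Qed.

Lemma rk_extend X I : I \in M -> I \subset X ->
  exists J, [/\ J \in M, J \subset X, I \subset J & #|J| = rk X].
Proof.
move=> IM IX; have [m] := ubnP (rk X - #|I|); elim: m I IM IX => // m IHm I IM IX.
have := rk_ge IM IX; rewrite leq_eqVlt => /orP[/eqP e _|lt bd].
  by exists I.
have [B [BM BX Be]] := rk_basis X.
have [|x] := Maug IM BM; first by rewrite Be.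
rewrite inE => /andP[xI xB] xIM.
have xIX : x |: I \subset X by rewrite subUset sub1set (subsetP BX) ?IX.
have [|||J [JM JX IJ Je]] := IHm (x |: I) => //.
  by rewrite cardsU1 xI subnS prednK ?subn_gt0 // -ltnS prednK ?subn_gt0.
by exists J; split=> //; apply: subset_trans IJ; apply: subsetUr.
Qed.

Definition cl X : {set 'I_n} := [set x | rk (x |: X) == rk X].

(** A single basis [I] of [X] decides membership. If [x] raised the rank, [I] could be augmented
    from a basis of [x |: X]; the new element cannot lie in [X], so it is [x]. *)
Lemma clE X I x : I \in M -> I \subset X -> #|I| = rk X ->
  (x \in cl X) = (x \in I) || (x |: I \notin M).
Proof.
move=> IM IX Ie; rewrite inE; apply/eqP/orP => [e|[xI|xIM]].
- have [|xI] := boolP (x \in I); [by left|right]; apply/negP => xIM.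
  have := rk_ge xIM (setUS [set x] IX).
  by rewrite cardsU1 xI e -Ie ltnn.
- by rewrite (setUidPr _) // sub1set (subsetP IX).
apply/eqP; rewrite eqn_leq [(rk X <= _)%N]rkS ?subsetUr // andbT leqNgt.
apply/negP => lt.
have [J [JM JX Je]] := rk_basis (x |: X).
have [|y] := Maug IM JM; first by rewrite Ie Je.
rewrite inE => /andP[yI yJ] yIM; have := subsetP JX _ yJ; rewrite !inE.
case/orP => [/eqP e|yX]; first by move: xIM; rewrite -e yIM.
have : y |: I \subset X by rewrite subUset sub1set yX.
by move/(rk_ge yIM); rewrite cardsU1 yI Ie ltnn.
Qed.

Lemma sub_cl X : X \subset cl X.
Proof. by apply/subsetP => x xX; rewrite inE (setUidPr _) // sub1set. Qed.

Lemma rk_cl X : rk (cl X) = rk X.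
Proof.
apply/eqP; rewrite eqn_leq [(rk X <= _)%N]rkS ?sub_cl // andbT leqNgt; apply/negP => lt.
have [I [IM IX Ie]] := rk_basis X; have [J [JM JX Je]] := rk_basis (cl X).
have [|y] := Maug IM JM; first by rewrite Ie Je.
rewrite inE => /andP[yI /(subsetP JX)]; rewrite (clE _ IM IX Ie) (negbTE yI) /=.
by move=> /negbTE ->.
Qed.

Lemma cl_id X : cl (cl X) = cl X.
Proof.
apply/eqP; rewrite eqEsubset sub_cl andbT; apply/subsetP => x.
rewrite !inE rk_cl => /eqP e; rewrite eqn_leq [(_ <= rk (x |: _))%N]rkS ?subsetUr //.
by rewrite andbT -e rkS // setUS // sub_cl.
Qed.

Lemma clS X Y : X \subset Y -> cl X \subset cl Y.
Proof.
move=> XY; have [I [IM IX Ie]] := rk_basis X.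
have [J [JM JY IJ Je]] := rk_extend IM (subset_trans IX XY).
apply/subsetP => x; rewrite (clE _ IM IX Ie) (clE _ JM JY Je).
case/orP => [xI|xIM]; first by rewrite (subsetP IJ).
by apply/orP; right; apply: contra xIM; apply: MS; apply: setUS.
Qed.

Lemma cl_sub X Y : X \subset cl Y -> cl X \subset cl Y.
Proof. by move/clS; rewrite cl_id. Qed.

Lemma rkU1 x X : (rk (x |: X) <= (rk X).+1)%N.
Proof.
have [J [JM JX <-]] := rk_basis (x |: X).
rewrite (cardsD1 x) -add1n leq_add ?leq_b1 // rk_ge //.
  by apply: MS JM; apply: subD1set.
apply/subsetP => y; rewrite inE => /andP[yx /(subsetP JX)].
by rewrite inE (negbTE yx).
Qed.

Lemma rk_notin_cl x X : x \notin cl X -> rk (x |: X) = (rk X).+1.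
Proof.
rewrite inE => h; apply/eqP; rewrite eqn_leq rkU1 ltn_neqAle eq_sym h.
by rewrite rkS ?subsetUr.
Qed.

(** Mac Lane-Steinitz exchange: [y |: X] already has rank rk X + 1, an upper bound for the rank of
    [x |: X], which adding [y] does not change. *)
Lemma cl_exchange x y X :
  y \in cl (x |: X) -> y \notin cl X -> x \in cl (y |: X).
Proof.
rewrite !inE => /eqP e yX; rewrite eqn_leq [(_ <= rk (x |: (y |: _)))%N]rkS ?subsetUr //.
by rewrite andbT setUCA e (rk_notin_cl (x := y)) ?inE // rkU1.
Qed.

Lemma cl_flat X : sc_is_flat M (cl X).
Proof.
move=> x; rewrite -{1}cl_id inE eq_sym => h.
by rewrite ltn_neqAle h rkS ?subsetUr.
Qed.

Definition lset l : {set 'I_n} := [set x in l].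

Lemma lset_cons x l : lset (x :: l) = x |: lset l.
Proof. by apply/setP => y; rewrite !inE. Qed.

Lemma lset_rcons x l : lset (rcons l x) = x |: lset l.
Proof. by apply/setP => y; rewrite !inE mem_rcons inE. Qed.

Lemma lset_nil : lset [::] = set0.
Proof. by apply/setP => y; rewrite !inE. Qed.

Lemma lset_cat l c : lset (l ++ c) = lset l :|: lset c.
Proof. by apply/setP => y; rewrite !inE mem_cat. Qed.

Lemma lset_take i l : lset (take i l) \subset lset l.
Proof. by apply/subsetP => y; rewrite !inE; apply: mem_take. Qed.

Lemma lset_enum X : lset (enum X) = X.
Proof. by apply/setP => y; rewrite inE mem_enum. Qed.

Lemma card_lset l : uniq l -> #|lset l| = size l.
Proof. by move=> /card_uniqP <-; apply: eq_card => y; rewrite inE. Qed.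

Definition indep_seq l := uniq l && (lset l \in M).

Lemma indep_take i l : indep_seq l -> indep_seq (take i l).
Proof.
by case/andP => ul lM; rewrite /indep_seq take_uniq //= (MS (lset_take i l)).
Qed.

Lemma rk_indep_seq l : indep_seq l -> rk (lset l) = size l.
Proof. by case/andP => ul lM; rewrite rk_indep // card_lset. Qed.

(** Each entry has to raise the rank of its prefix by one. This form is the one compatible with
    flags of closures of prefixes. *)
Lemma indep_seqP x0 l :
  reflect (forall i, (i < size l)%N -> nth x0 l i \notin cl (lset (take i l)))
          (indep_seq l).
Proof.
apply: (iffP idP) => [il i si|].
  rewrite inE -lset_rcons -take_nth //.
  rewrite !rk_indep_seq ?indep_take // !size_take si.
  by move: si; rewrite leq_eqVlt => /orP[/eqP <-|->]; rewrite ?ltnn ?eqxx; lia.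
elim/last_ind: l => [_|l x IHl H]; first by rewrite /indep_seq lset_nil M0.
have /IHl il : forall i, (i < size l)%N -> nth x0 l i \notin cl (lset (take i l)).
  move=> i si; have := H i; rewrite size_rcons ltnS (ltnW si) => /(_ isT).
  by rewrite nth_rcons si -cats1 takel_cat // ltnW.
have := H (size l); rewrite size_rcons ltnSn => /(_ isT).
rewrite nth_rcons ltnn eqxx -cats1 take_cat ltnn subnn take0 cats0 => xl.
have rx := rk_notin_cl xl; rewrite cats1 /indep_seq lset_rcons.
have xl' : x \notin l.
  by apply: contra xl => xl; apply: (subsetP (sub_cl _)); rewrite inE.
rewrite rcons_uniq xl'; case/andP: (il) => -> lM /=.
have [I [IM IX Ie]] := rk_basis (x |: lset l).
suff -> : x |: lset l = I by [].
apply/esym/eqP; rewrite eqEcard IX Ie rx rk_indep // cardsU1.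
by rewrite inE xl' /= add1n leqnn.
Qed.

End Matroid.

(** * Invariance of the localized Lefschetz number *)

(** The case i = m covers a predicate that holds nowhere on the list, where [find] returns the
    length. *)
Lemma find_iota (p : pred nat) m i : (i <= m)%N ->
  (forall j, (j < i)%N -> ~~ p j) -> ((i < m)%N -> p i) ->
  find p (iota 0 m) = i.
Proof.
move=> im before at_i; have -> : m = (i + (m - i))%N by rewrite subnKC.
rewrite iotaD find_cat size_iota add0n ifF; last first.
  by apply/hasPn => j; rewrite mem_iota => /andP[_]; apply: before.
case: ltngtP im => // [lt|<-] _; last by rewrite subnn addn0.
by rewrite -(subnSK lt) /= at_i // addn0.
Qed.

Section Invariant.
Import mathcomp.boot.fintype mathcomp.boot.finset.
Import GRing.Theory Num.Theory.
Local Open Scope ring_scope.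
Variables (n : nat) (M : {set {set 'I_n}}) (k : nat).
Hypotheses (matM : sc_is_matroid M) (k_gt0 : (0 < k)%N).
Notation chain := {ffun {set 'I_n} -> rat}.
Implicit Types (F G : {set 'I_n}) (l m : seq {set 'I_n}).

(** Between flats, inclusion with growth of the rank is strict inclusion; the rank form bounds the
    length of flags directly. *)
Definition flag_rel F G := (F \subset G) && (rk M F < rk M G)%N.

Definition flag l :=
  sorted flag_rel l && all (fun F => (cl M F == F) && (rk M F < k)%N) l.

Lemma flag_rel_trans : transitive flag_rel.
Proof.
move=> G F H /andP[FG rFG] /andP[GH rGH].
by rewrite /flag_rel (subset_trans FG GH) (ltn_trans rFG rGH).
Qed.

Lemma flag_subseq l m : subseq m l -> flag l -> flag m.
Proof.
move=> ml /andP[sl /allP al]; rewrite /flag (subseq_sorted flag_rel_trans ml sl).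
by apply/allP => F Fm; apply/al/(mem_subseq ml).
Qed.

Lemma flag_size F l : flag (F :: l) -> (size l + rk M F < k)%N.
Proof.
elim: l F => [|G l IHl] F.
  by rewrite /flag /= andbT add0n => /andP[].
move=> flFGl; have flGl : flag (G :: l) by apply: flag_subseq flFGl; apply: subseq_cons.
have := IHl _ flGl; case/andP: flFGl => /= /andP[/andP[_ rFG] _] _; lia.
Qed.

Section Complex.
Variable K : {set {set 'I_n}}.

Definition carrier l := if l is F :: _ then sc_induced K (~: F) else K.

(** The smallest flat of a nonempty subflag contains the smallest flat of the flag, so its
    complement is smaller. *)
Lemma carrier_subseq l m : subseq m l -> flag l -> m != [::] ->
  carrier m \subset carrier l.
Proof.
case: l => [|F l]; first by move/eqP->.
case: m => [//|G m] sml fl _; apply/subsetP => s; rewrite !inE => /andP[-> sG].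
apply: (subset_trans sG); rewrite setCS.
have : G \in F :: l by apply: (mem_subseq sml); rewrite mem_head.
rewrite inE => /orP[/eqP->//|Gl].
case/andP: fl => /= /(order_path_min flag_rel_trans)/allP/(_ _ Gl).
by case/andP.
Qed.

(** The range of [p] matches the bound on eta: level p is available when p < eta, and eta + rk F >=
    k + 1. *)
Definition flats_acyclic := forall F p, sc_is_flat M F -> (rk M F < k)%N ->
  (p + rk M F <= k)%N -> acyc (sc_induced K (~: F)) p.

Hypotheses (K0 : set0 \in K) (acycK : flats_acyclic).

(* Acyclic carriers: [e = 0], [h = 0] yields chain maps up to sign, and [e = 1],
   [h = f' - f] yields chain homotopies. *)
Lemma carrier_lift (e : nat) (h : seq {set 'I_n} -> chain) (d0 : chain) :
  (e <= 1)%N ->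
  (forall F, sc_chain_on (sc_induced K (~: F)) e d0) ->
  bd d0 = h [::] ->
  (forall l, flag l -> l != [::] ->
     sc_chain_on (carrier l) (size l + e).-1 (h l)) ->
  (forall l, flag l -> bd (h l) = dsum l h) ->
  exists2 D : seq {set 'I_n} -> chain, D [::] = d0 &
    forall l, flag l ->
      (l != [::] -> sc_chain_on (carrier l) (size l + e) (D l)) /\
      bd (D l) = h l - dsum l D.
Proof.
move=> e1 d0c d0h hc hbd.
(* Induction on the length of flags. Ranks increase strictly and stay below k, so no flag has more
   than k members. *)
suff /(_ k)[D D0 DP] : forall j : nat, exists2 D : seq {set 'I_n} -> chain,
    D [::] = d0 & forall l, flag l -> (size l <= j)%N ->
      (l != [::] -> sc_chain_on (carrier l) (size l + e) (D l)) /\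
      bd (D l) = h l - dsum l D.
  exists D => // -[|F l] fl; apply: DP => //.
  by have := flag_size fl; rewrite /=; lia.
elim=> [|j [D D0 IHD]].
  exists (fun=> d0) => // -[|F l] // _ _; split=> //=.
  by rewrite subr0.
have step l : exists d, flag l -> size l = j.+1 ->
    sc_chain_on (carrier l) (size l + e) d /\ bd d = h l - dsum l D.
  have [fl|] := boolP (flag l); last by exists 0.
  have [sl|] := eqVneq (size l) j.+1; last first.
    by move=> /eqP sl; exists 0 => _ /sl.
  case: l => [//|F l] in fl sl *.
  have [flF rF] : sc_is_flat M F /\ (rk M F < k)%N.
    case/andP: fl => _ /= /andP[/andP[/eqP cF rF] _]; split=> //.
    by rewrite -cF; apply: cl_flat.
  have D_sub m : subseq m (F :: l) -> (size m).+1 = size (F :: l) ->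
      sc_chain_on (carrier (F :: l)) (size (F :: l) + e).-1 (D m) /\
      bd (D m) = h m - dsum m D.
    move=> ml sm; have fm := flag_subseq ml fl.
    have [|c b] := IHD _ fm; first by lia.
    (* The only face of a one-member flag is the empty flag, whose carrier is no constraint; this is
       why [d0] must lie in every carrier. *)
    split=> //; have [m0|mN0] := eqVneq m [::].
      have -> : ((size (F :: l) + e).-1 = e)%N by rewrite -sm m0.
      by rewrite m0 D0; apply: d0c.
    rewrite -sm addSn; apply: (chain_onS (carrier_subseq ml fl mN0)).
    exact: c.
  have pk : (size l + e + rk M F <= k)%N by have := flag_size fl; lia.
  have [||d dc db] := @acycK F _ flF rF pk (h (F :: l) - dsum (F :: l) D).
  - apply: chain_onB; first exact: hc.
    apply: (@dsum_closed _ _ (sc_chain_on _ _)).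
    + exact: chain_on0.
    + exact: chain_onB.
    + by move=> m ml sm; case: (D_sub m ml sm).
  - rewrite bdB hbd // bd_dsum; apply/eqP.
    (* The right-hand side is a cycle: bd D m = h m - dsum m D on faces, and the iterated face sum
       of [D] vanishes by [dsumK]. *)
    rewrite subr_eq0 -[X in X == _]subr0 -[X in _ - X](dsumK (F :: l) D) -dsumB.
    apply/eqP/eq_dsum => m ml sm; by case: (D_sub m ml sm).
  by exists d.
have [D1 D1P] := choice step.
pose D' l := if size l == j.+1 then D1 l else D l.
exists D' => // l fl sl; have -> : dsum l D' = dsum l D.
  apply: eq_dsum => m _ sm; rewrite /D' ifF //.
  by apply/negbTE; rewrite neq_ltn sm sl.
rewrite /D'; have [e'|lj] := eqVneq (size l) j.+1.
  by have [] := D1P l fl e'.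
by apply: (IHD l fl); move: sl; rewrite leq_eqVlt (negbTE lj) ltnS.
Qed.

Definition flag_map (f : seq {set 'I_n} -> chain) :=
  [/\ f [::] = emptyc n,
      forall l, flag l -> l != [::] -> sc_chain_on (carrier l) (size l) (f l) &
      forall l, flag l -> bd (f l) = dsum l f].

(** With h = 0 the lift satisfies bd (g l) = - dsum l g. Negating it on flags of odd length gives a
    chain map, since a flag and its faces have lengths of opposite parity. *)
Lemma flag_map_exists : exists f, flag_map f.
Proof.
have [||||g g0 gP] := @carrier_lift 0 (fun=> 0) (emptyc n) isT.
- move=> F s; rewrite ffunE pnatr_eq0 eqb0 negbK => /eqP ->.
  by rewrite cards0 !inE K0 sub0set.
- exact: bd_emptyc.
- by move=> l _ _; apply: chain_on0.
- by move=> l _; rewrite bd0 dsum0.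
exists (fun l => if odd (size l) then - g l else g l); split=> [//|l fl lN0|l fl].
  have [/(_ lN0) c _] := gP l fl; rewrite addn0 in c.
  case: ifP => // _; rewrite -sub0r; apply: chain_onB => //; exact: chain_on0.
have [_ b] := gP l fl; case: ifP => ol.
  rewrite bdN b sub0r opprK; apply: eq_dsum => m _ sm.
  by move: ol; rewrite -sm /= => /negbTE ->.
rewrite b sub0r -dsumN; apply: eq_dsum => m _ sm.
by move: ol; rewrite -sm /= => /negbFE ->.
Qed.

Lemma flag_map_homotopy f f' : flag_map f -> flag_map f' ->
  exists2 D, D [::] = 0 & forall l, flag l ->
    (l != [::] -> sc_chain_on (carrier l) (size l).+1 (D l)) /\
    bd (D l) = f' l - f l - dsum l D.
Proof.
move=> [f0 fc fb] [f0' fc' fb'].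
have [||||D D0 DP] := @carrier_lift 1 (fun l => f' l - f l) 0 isT.
- by move=> F; apply: chain_on0.
- by rewrite bd0 f0 f0' subrr.
- by move=> l fl lN0; rewrite addn1; apply: chain_onB; [apply: fc'|apply: fc].
- by move=> l fl; rewrite bdB fb // fb' // dsumB.
by exists D => // l /DP; rewrite addn1.
Qed.

Variable x0 : 'I_n.

(** For an independent [c] of length k this is a complete flag of ranks 0, ..., k - 1. It starts
    with the set of loops and omits the closure of [c] itself. *)
Definition clflag (c : seq 'I_n) : seq {set 'I_n} :=
  [seq cl M (lset (take i c)) | i <- iota 0 k].

Lemma size_clflag c : size (clflag c) = k.
Proof. by rewrite size_map size_iota. Qed.

Lemma rk_cl_take c i : indep_seq M c -> size c = k -> (i <= k)%N ->
  rk M (cl M (lset (take i c))) = i.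
Proof.
move=> ic sc ik; rewrite rk_cl // rk_indep_seq ?indep_take // size_take sc.
by case: ltngtP ik.
Qed.

Lemma flag_clflag c : indep_seq M c -> size c = k -> flag (clflag c).
Proof.
move=> ic sc; apply/andP; split.
  apply/(sortedP set0) => i; rewrite size_clflag => ik.
  rewrite !(nth_map 0) ?size_iota ?(ltnW ik) // !nth_iota ?(ltnW ik) // !add0n.
  rewrite /flag_rel !rk_cl_take ?ltnSn ?andbT // ?(ltnW ik) //; last exact: ltnW (ltnW ik).
  apply: clS => //; apply/subsetP => x; rewrite !inE.
  by rewrite -{1}(take_takel c (leqnSn i)) => /mem_take.
apply/allP => _ /mapP[i + ->]; rewrite mem_iota add0n /= => ik.
by rewrite cl_id // eqxx rk_cl_take // ltnW.
Qed.

Variable S : pred {set 'I_n}.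
Hypothesis S_basis : forall A, S A -> A \in M /\ #|A| = k.
Hypothesis S_closed : forall A B, S A -> B \in M -> #|B| = k ->
  A :|: B \in K -> #|A :|: B| = k.+1 -> S B.

(* [S] plays the role of a union of connected components of RG. *)
Definition flag_trace (f : seq {set 'I_n} -> chain) : rat :=
  \sum_(c : k.-tuple 'I_n | S (lset c)) ev (f (clflag c)) c.

Lemma S_indep (c : k.-tuple 'I_n) : S (lset c) -> indep_seq M c.
Proof.
case/S_basis => cM cc; rewrite /indep_seq cM andbT; apply/card_uniqP.
by rewrite size_tuple -[RHS]cc; apply: eq_card => y; rewrite inE.
Qed.

Lemma tval_insubd (c : k.-tuple 'I_n) (s : seq 'I_n) :
  size s = k -> tval (insubd c s) = s.
Proof. by move=> /eqP sk; apply: insubdK. Qed.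

Definition swp j (c : seq 'I_n) :=
  take j c ++ nth x0 c j.+1 :: nth x0 c j :: drop j.+2 c.

Lemma swpE (l1 l2 : seq 'I_n) a b : swp (size l1) (l1 ++ a :: b :: l2) = l1 ++ b :: a :: l2.
Proof.
rewrite /swp take_size_cat // !nth_cat ltnNge leqnSn ltnn subnn subSnn /=.
by rewrite drop_cat ltnNge -addn2 leq_addr /= addKn /= drop0.
Qed.

Lemma split2 j (c : seq 'I_n) : (j.+1 < size c)%N ->
  exists (l1 l2 : seq 'I_n) a b, size l1 = j /\ c = l1 ++ a :: b :: l2.
Proof.
move=> jc; exists (take j c), (drop j.+2 c), (nth x0 c j), (nth x0 c j.+1).
rewrite size_take (ltnW jc); split=> //.
by rewrite -drop_nth // -drop_nth ?cat_take_drop // ltnW.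
Qed.

Lemma split1 j (c : seq 'I_n) : (j < size c)%N ->
  exists (l1 l2 : seq 'I_n) a, size l1 = j /\ c = l1 ++ a :: l2.
Proof.
move=> jc; exists (take j c), (drop j.+1 c), (nth x0 c j).
by rewrite size_take jc -drop_nth ?cat_take_drop.
Qed.

Lemma sum_faces0 (G : seq {set 'I_n} -> chain) :
  G [::] = 0 ->
  (forall l s, flag l -> l != [::] -> G l s != 0 -> s \in carrier l) ->
  \sum_(c : k.-tuple 'I_n | S (lset c)) ev (dsum (clflag c) G) c = 0.
Proof.
move=> G0 Gc.
have evdsum (c : k.-tuple 'I_n) : ev (dsum (clflag c) G) c =
    \sum_(i < k) (-1) ^+ i * ev (G (take i (clflag c) ++ drop i.+1 (clflag c))) c.
  rewrite dsumE size_clflag [LHS](raddf_sum (evl c)); apply: eq_bigr => i _ /=.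
  by case: ifP => oi; rewrite -signr_odd oi /= ?mul1r // /evl evN mulN1r.
under eq_bigr do rewrite evdsum.
rewrite exchange_big big1 // => i _; rewrite -big_distrr /=.
suff -> : \sum_(c : k.-tuple 'I_n | S (lset c))
    ev (G (take i (clflag c) ++ drop i.+1 (clflag c))) c = 0 by rewrite mulr0.
case: i => [[|j] ik] /=.
  (* The face omitting the set of loops starts with the closure of the first entry of [c], so its
     carrier avoids that entry. For k = 1 the face is empty and [G [::]] = 0 is used. *)
  apply: big1 => c Sc; apply/eqP/negPn/negP => /ev_neq0[_ Gn0].
  have ic := S_indep Sc; rewrite take0 /= in Gn0.
  have dE : drop 1 (clflag c) = [seq cl M (lset (take i c)) | i <- iota 1 k.-1].
    by rewrite /clflag -map_drop drop_iota subn1.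
  have fd : flag (drop 1 (clflag c)).
    by apply: flag_subseq (drop_subseq _ _) (flag_clflag ic (size_tuple c)).
  move: (Gc _ (lset c) fd) Gn0; rewrite dE.
  case: k.-1 => [_|r /(_ isT) H /H] /=; first by rewrite G0 ffunE eqxx.
  rewrite !inE => /andP[_ /subsetP]; case: (tval c) (size_tuple c) => [|x c'] sc.
    by move: k_gt0; rewrite -sc.
  move/(_ x); rewrite !inE eqxx /= => /(_ isT) /negP; apply.
  have /subsetP := sub_cl M (lset [:: x]); move/(_ x).
  by rewrite !inE eqxx /= take0 => /(_ isT).
(* Only the prefix of length j + 1 changes as a set when entries j and j + 1 are swapped, and its
   closure is the omitted member. *)
pose phi (c : k.-tuple 'I_n) : k.-tuple 'I_n := insubd c (swp j c).
refine (@sum_signed_involution _ (fun c : k.-tuple 'I_n => S (lset c)) _ phi _) => c Sc.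
have [|l1 [l2 [a [b [sl1 cE]]]]] := @split2 j c; first by rewrite size_tuple.
have szl : size (l1 ++ a :: b :: l2) = k by rewrite -cE size_tuple.
have sE : tval (phi c) = l1 ++ b :: a :: l2.
  by rewrite tval_insubd ?cE -sl1 ?swpE // -szl !size_cat.
have Sc' : lset (phi c) = lset c.
  rewrite /lset sE cE; apply/setP => y; rewrite !inE !mem_cat !inE.
  by congr (_ || _); rewrite orbCA.
split; first by rewrite Sc'.
  by apply: val_inj; rewrite /= tval_insubd ?sE -?sl1 ?swpE ?cE.
have -> : take j.+1 (clflag (phi c)) ++ drop j.+2 (clflag (phi c)) =
          take j.+1 (clflag c) ++ drop j.+2 (clflag c).
  rewrite /clflag -!map_take -!map_drop -!map_cat; apply/eq_in_map => i.
  rewrite mem_cat take_iota drop_iota !mem_iota => ij.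
  congr (cl M _); rewrite sE cE !take_cat.
  case: ltnP => // il1.
  have : (i - size l1 != 1)%N by rewrite sl1; lia.
  case: (i - size l1)%N => [|[//|r]] // _.
  by rewrite !lset_cat /= !lset_cons setUCA.
by rewrite sE ev_swap -cE.
Qed.

Definition rep i v (c : seq 'I_n) := take i c ++ v :: drop i.+1 c.

Lemma repE (l1 l2 : seq 'I_n) a v : rep (size l1) v (l1 ++ a :: l2) = l1 ++ v :: l2.
Proof.
rewrite /rep take_size_cat //; congr (_ ++ _ :: _).
by rewrite -cat_rcons drop_size_cat // size_rcons.
Qed.

(** The prefixes tested have lengths 1 to k - 1. If [v] enters none of their closures, [find]
    returns k - 1, the position of the last entry. *)
Definition cl_index v (c : seq 'I_n) :=
  find (fun j => v \in cl M (lset (take j.+1 c))) (iota 0 k.-1).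

(* If [v] enters the closures of the prefixes of [c] exactly at the [i]-th
   element, then replacing that element by [v] preserves all these closures. *)
Lemma cl_index_rep v a (l1 l2 : seq 'I_n) : size (l1 ++ a :: l2) = k ->
  indep_seq M (l1 ++ a :: l2) -> v \notin cl M set0 ->
  cl_index v (l1 ++ a :: l2) = size l1 ->
  [/\ indep_seq M (l1 ++ v :: l2),
      forall j, (j < k)%N -> cl M (lset (take j (l1 ++ v :: l2))) =
                             cl M (lset (take j (l1 ++ a :: l2))) &
      cl_index a (l1 ++ v :: l2) = size l1].
Proof.
set c := l1 ++ a :: l2; set c' := l1 ++ v :: l2; set i := size l1.
move=> sc ic v0 vi; have ik : (i < k)%N.
  by rewrite -sc size_cat /= -/i; lia.
have sc' : size c' = k by rewrite -sc !size_cat.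
have v_before j : (j < i)%N -> v \notin cl M (lset (take j.+1 c)).
  move=> ji; have := @before_find _ 0%N (fun j => v \in cl M (lset (take j.+1 c)))
     (iota 0 k.-1) j; rewrite -/(cl_index v c) vi => /(_ ji).
  by rewrite nth_iota ?add0n; [move=> /negbT | lia].
(* At position 0 there is no earlier prefix, and the claim is that [v] is not a loop. *)
have v_at : v \notin cl M (lset l1).
  have -> : l1 = take i c by rewrite take_size_cat.
  case ei: i => [|i']; first by rewrite take0 lset_nil.
  by apply: v_before; rewrite ei.
have v_after : (i < k.-1)%N -> v \in cl M (a |: lset l1).
  move=> ik1; have := @nth_find _ 0%N (fun j => v \in cl M (lset (take j.+1 c)))
     (iota 0 k.-1); rewrite has_find -/(cl_index v c) vi size_iota => /(_ ik1).
  rewrite nth_iota // add0n /c -cat_rcons take_size_cat ?size_rcons //.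
  by rewrite lset_rcons.
have a_at : a \notin cl M (lset l1).
  have := elimT (indep_seqP matM a c) ic i; rewrite sc ik => /(_ isT).
  by rewrite nth_cat ltnn subnn take_size_cat.
have clE' j : (j < k)%N -> cl M (lset (take j c')) = cl M (lset (take j c)).
  move=> jk; rewrite /c /c' !take_cat; case: ltnP => // ij.
  case er: (j - size l1)%N => [|r]; first by rewrite !take0.
  rewrite /= !lset_cat !lset_cons.
  have va : v \in cl M (a |: lset l1) by apply: v_after; move: er; rewrite -/i; lia.
  (* Over the prefix [l1], each of [a] and [v] lies in the closure of the other, so every longer
     prefix keeps its closure. *)
  have av := cl_exchange matM va v_at.
  apply/eqP; rewrite eqEsubset !cl_sub // !subUset !sub1set; apply/and3P; split.
  - by apply: (subset_trans _ (sub_cl _ _)); apply: subsetUl.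
  - apply: (subsetP (clS matM _) _ av); rewrite subUset sub1set !inE eqxx orbT /=.
    by rewrite subsetUl.
  - by apply: (subset_trans _ (sub_cl _ _)); rewrite setUA subsetUr.
  - by apply: (subset_trans _ (sub_cl _ _)); apply: subsetUl.
  - apply: (subsetP (clS matM _) _ va); rewrite subUset sub1set !inE eqxx orbT /=.
    by rewrite subsetUl.
  - by apply: (subset_trans _ (sub_cl _ _)); rewrite setUA subsetUr.
split=> //.
  apply/(indep_seqP matM a) => j; rewrite sc' => jk.
  rewrite clE' //; have := elimT (indep_seqP matM a c) ic j; rewrite sc jk => /(_ isT).
  rewrite /c /c' !nth_cat -/i; case: ltnP => // ij.
  case ej: (j - i)%N => [|r] //= _.
  have -> : j = i by apply/eqP; rewrite eqn_leq ij -subn_eq0 ej.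
  by rewrite take_size_cat.
(* In the new sequence [a] enters at the same position, so the replacement will be an involution. *)
apply: find_iota => [|j ji|ik1]; first by lia.
  rewrite clE'; last by lia.
  apply: contra a_at; apply/subsetP/clS => //.
  have -> : l1 = take i c by rewrite take_size_cat.
  by rewrite -{1}(take_takel c ji); apply: lset_take.
rewrite clE'; last by lia.
rewrite /c -cat_rcons take_size_cat ?size_rcons // lset_rcons.
by apply: (subsetP (sub_cl _ _)); rewrite !inE eqxx.
Qed.

Lemma sum_cofaces0 (G : seq {set 'I_n} -> chain) :
  (forall c : seq 'I_n, indep_seq M c -> size c = k ->
     sc_chain_on (sc_induced K (~: cl M set0)) k.+1 (G (clflag c))) ->
  \sum_(c : k.-tuple 'I_n | S (lset c)) ev (bd (G (clflag c))) c = 0.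
Proof.
move=> Gc; under eq_bigr do rewrite ev_bd.
rewrite pair_big /=.
(* Pairs outside [Q] contribute 0: a nonzero coefficient has distinct entries, and the carrier
   condition puts the simplex in [K] and off the loops. *)
pose Q (p : k.-tuple 'I_n * 'I_n) := [&& uniq (p.2 :: p.1),
  p.2 |: lset p.1 \in K & p.2 \notin cl M set0].
rewrite (bigID Q) /= addrC big1 ?add0r; last first.
  move=> [c v] /= /andP[]; rewrite andbT => Sc nQ; apply/eqP/negPn/negP => evn0.
  case/negP: nQ; have [uvc Gn0] := @ev_neq0 _ (G (clflag c)) (v :: c) evn0.
  have := Gc _ (S_indep Sc) (size_tuple c) _ Gn0.
  rewrite !inE => /andP[/andP[cK /subsetP c0] _].
  rewrite /Q uvc -lset_cons cK /=.
  by have := c0 v; rewrite !inE eqxx /= => /(_ isT).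
pose phi (p : k.-tuple 'I_n * 'I_n) :=
  (insubd p.1 (rep (cl_index p.2 p.1) p.2 p.1), nth x0 p.1 (cl_index p.2 p.1)).
have phiE c v : phi (c, v) =
  (insubd c (rep (cl_index v c) v c), nth x0 c (cl_index v c)) by [].
clearbody phi.
apply: (@sum_signed_involution _ _ _ phi) => -[c v] /=.
rewrite andbT => /andP[Sc /and3P[uvc cK v0]].
have ic := S_indep Sc; have sc := size_tuple c.
have [|l1 [l2 [a [sl1 cE]]]] := @split1 (cl_index v c) c.
  rewrite sc; have := find_size (fun j => v \in cl M (lset (take j.+1 c))) (iota 0 k.-1).
  by rewrite size_iota -/(cl_index v c); lia.
have szl : size (l1 ++ a :: l2) = k by rewrite -cE size_tuple.
pose c' : k.-tuple 'I_n := insubd c (l1 ++ v :: l2).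
have phE : phi (c, v) = (c', a).
  by rewrite phiE -sl1 [in rep _ _ _]cE repE [in nth _ _ _]cE nth_cat ltnn subnn.
have vE : tval c' = l1 ++ v :: l2.
  by rewrite tval_insubd // -szl !size_cat.
clearbody c'.
have [||||ic' clE' ai] := @cl_index_rep v a l1 l2; rewrite -?cE //.
have fE : clflag c' = clflag c.
  apply/eq_in_map => j; rewrite mem_iota add0n /= => jk.
  by rewrite vE clE' // cE.
have setE : a |: lset c' = v |: lset c.
  by rewrite vE cE !lset_cat !lset_cons setUCA [RHS]setUCA; congr (_ :|: _); rewrite setUCA.
have uac : uniq (a :: c').
  rewrite (perm_uniq (_ : perm_eq _ (v :: c))) //; apply/permP => p.
  rewrite vE cE /= !count_cat /= addnCA [RHS]addnCA; congr (_ + _)%N.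
  by rewrite addnCA.
have UE : lset c :|: lset c' = v |: lset c.
  apply/setP => y; rewrite !inE vE cE !mem_cat !inE.
  by case: (y \in l1); case: (y \in l2); case: (y == a); case: (y == v).
rewrite phE /=; split.
- rewrite andbT /Q /= setE cK /=; apply/andP; split.
    (* Both [c] and [c'] are facets of the simplex [v |: lset c] of [K]. This is where closure of
       [S] under adjacency enters. *)
    apply: (S_closed Sc).
    + by case/andP: ic' => _; rewrite -vE.
    + by rewrite card_lset; [apply: size_tuple | case/andP: uac].
    + by rewrite UE.
    + by rewrite UE -lset_cons card_lset //; congr _.+1; apply: size_tuple.
  have /andP[-> ->] /= : (a \notin c') && uniq c' := uac.
  have l1c : (size l1 < size c)%N by rewrite cE size_cat /= addnS ltnS leq_addr.
  have := elimT (indep_seqP matM a c) ic (size l1) l1c.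
  rewrite [in nth _ _ _]cE nth_cat ltnn subnn /=; apply: contra; apply/subsetP/clS => //.
  exact: sub0set.
- rewrite phiE vE ai repE nth_cat ltnn subnn /=; congr (_, _).
  by apply: val_inj; rewrite /= tval_insubd ?szl.
- by rewrite fE vE cE; apply: (ev_swap_head a l1 v l2).
Qed.

(** The homotopy equation writes the difference of the traces as a boundary sum plus a face sum, and
    both vanish. *)
Lemma flag_trace_eq f f' : flag_map f -> flag_map f' ->
  flag_trace f = flag_trace f'.
Proof.
move=> mf mf'; have [D D0 DP] := flag_map_homotopy mf mf'.
apply/eqP; rewrite eq_sym -subr_eq0 /flag_trace -sumrB; apply/eqP.
transitivity (\sum_(c : k.-tuple 'I_n | S (lset c))
    (ev (bd (D (clflag c))) c + ev (dsum (clflag c) D) c)).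
  apply: eq_bigr => c /S_indep ic; rewrite -evB.
  have [_ ->] := DP _ (flag_clflag ic (size_tuple c)).
  by rewrite [in RHS]evB subrK.
rewrite big_split /= sum_cofaces0 ?sum_faces0 ?addr0 //.
  move=> l s fl lN0 Ds; have [/(_ lN0) /(_ _ Ds)] := DP l fl.
  by case/andP.
move=> c ic sc; have fl := flag_clflag ic sc.
have fN0 : clflag c != [::] by rewrite -size_eq0 size_clflag -lt0n.
have [/(_ fN0) + _] := DP _ fl; rewrite size_clflag.
by rewrite /carrier {1}/clflag -{1}(prednK k_gt0) /= take0 lset_nil.
Qed.

End Complex.
End Invariant.

(** * Traces of the chain maps given by independent sets *)

Section Bases.
Import mathcomp.boot.fintype mathcomp.boot.finset.
Import GRing.Theory Num.Theory Order.TTheory.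
Local Open Scope ring_scope.
Variables (n : nat) (M : {set {set 'I_n}}) (k : nat) (x0 : 'I_n).
Hypotheses (matM : sc_is_matroid M) (k_gt0 : (0 < k)%N).
Notation chain := {ffun {set 'I_n} -> rat}.
Implicit Types (F G : {set 'I_n}) (a c : seq 'I_n).

Definition pick_out a F := nth x0 a (find (fun y => y \notin F) a).

Definition basis_map a (l : seq {set 'I_n}) : chain := simp (map (pick_out a) l).

Lemma pick_out_in a F : has (fun y => y \notin F) a ->
  pick_out a F \in a /\ pick_out a F \notin F.
Proof.
by move=> h; split; [rewrite mem_nth // -has_find | apply: (nth_find x0 h)].
Qed.

Lemma pick_outS a F G : F \subset G -> pick_out a F \notin G ->
  pick_out a G = pick_out a F.
Proof.
move=> /subsetP FG; rewrite /pick_out; elim: a => [//|x a IHa] /=.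
have [xF|xF] := boolP (x \in F); last by move=> /= ->.
by rewrite (FG _ xF); apply: IHa.
Qed.

Lemma has_out a F : indep_seq M a -> size a = k -> (rk M F < k)%N ->
  has (fun y => y \notin F) a.
Proof.
move=> ia sa; apply: contraTT => /hasPn aF; rewrite -leqNgt -sa -(rk_indep_seq matM ia).
by apply: rkS => //; apply/subsetP => y; rewrite inE => /aF; rewrite negbK.
Qed.

(** A vertex map induces a chain map. The vertex picked for a member of the flag lies outside that
    member, hence outside the smallest one, as the carrier demands. *)
Lemma basis_map_flag (K : {set {set 'I_n}}) a :
  indep_seq M a -> size a = k -> (forall s : {set 'I_n}, s \subset lset a -> s \in K) ->
  flag_map M k K (basis_map a).
Proof.
move=> ia sa aK; split=> [//|l fl lN0 s|l _]; last by rewrite bd_simp dsum_map.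
move=> /simp_supp[sE]; rewrite size_map => ->; rewrite eqxx andbT.
case: l => [//|F l] in fl lN0 sE *.
have out G : G \in F :: l -> pick_out a G \in a /\ pick_out a G \notin F.
  move=> Gl; have /andP[_ rG] := allP (proj2 (andP fl)) _ Gl.
  have [pa pG] := pick_out_in (has_out ia sa rG); split=> //.
  apply: contra pG; apply/subsetP; move: Gl; rewrite inE => /orP[/eqP-> //|Gl].
  case/andP: fl => /= /(order_path_min (@flag_rel_trans _ _))/allP/(_ _ Gl).
  by case/andP.
have sub y : y \in s -> y \in a /\ y \notin F.
  by rewrite sE inE => /mapP[G /out h ->].
rewrite !inE; apply/andP; split.
  by apply: aK; apply/subsetP => y; rewrite inE => /sub[].
by apply/subsetP => y; rewrite inE => /sub[].
Qed.

Lemma mem_cl_take c i y : indep_seq M c -> y \in c ->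
  (y \in cl M (lset (take i c))) = (y \in take i c).
Proof.
move=> ic yc; apply/idP/idP => [ycl|yt]; last first.
  by apply: (subsetP (sub_cl _ _)); rewrite inE.
have jc : (index y c < size c)%N by rewrite index_mem.
have := elimT (indep_seqP matM y c) ic _ jc; rewrite nth_index //.
apply: contraNT => yt; apply: (subsetP (clS matM _) _ ycl).
have ij : (i <= index y c)%N by rewrite leqNgt -in_take.
by rewrite -{1}(take_takel c ij); apply: lset_take.
Qed.

(** The i-th pick is an entry of [c] outside its first i entries. If it came later than position i,
    it would also be the next pick, against uniqueness. *)
Lemma pick_out_clflag a c : indep_seq M c -> size c = k -> lset c = lset a ->
  indep_seq M a -> size a = k ->
  uniq (map (pick_out a) (clflag M k c)) -> map (pick_out a) (clflag M k c) = c.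
Proof.
move=> ic sc ca ia sa; rewrite -map_comp; set b := pick_out a \o _ => ub.
have ma y : (y \in a) = (y \in c) by have /setP/(_ y) := ca; rewrite !inE.
have bP i : (i < k)%N -> b i \in c /\ b i \notin take i c.
  move=> ik; have rF : (rk M (cl M (lset (take i c))) < k)%N.
    by rewrite (rk_cl_take matM ic sc) // ltnW.
  have [ba bcl] := pick_out_in (has_out ia sa rF); rewrite ma in ba.
  by split=> //; rewrite -(mem_cl_take i ic ba).
apply: (@eq_from_nth _ x0); first by rewrite size_map size_iota.
rewrite size_map size_iota => i ik.
rewrite (nth_map 0%N) ?size_iota // nth_iota // add0n.
have [bc bt] := bP i ik; have := bc; rewrite -{1}(cat_take_drop i c) mem_cat (negbTE bt) /=.
rewrite (drop_nth x0) ?sc // inE => /orP[/eqP //|bd].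
have uc : uniq c by case/andP: ic.
have ik1 : (i.+1 < k)%N.
  by rewrite ltnNge; apply/negP => ki; move: bd; rewrite drop_oversize // sc.
have bt1 : b i \notin take i.+1 c.
  by move: uc; rewrite -{1}(cat_take_drop i.+1 c) cat_uniq => /and3P[_ /hasPn/(_ _ bd)].
have e : b i.+1 = b i.
  apply: pick_outS; last by rewrite -/(b i) mem_cl_take.
  by apply: clS => //; rewrite -{1}(take_takel c (leqnSn i)); apply: lset_take.
have := nth_uniq x0 (s := map b (iota 0 k)) (i := i) (j := i.+1).
rewrite size_map size_iota => /(_ ik ik1 ub).
rewrite !(nth_map 0%N) ?size_iota // !nth_iota // !add0n e eqxx.
by rewrite ltn_eqF.
Qed.

Lemma pick_out_self a : indep_seq M a -> size a = k ->
  map (pick_out a) (clflag M k a) = a.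
Proof.
move=> ia sa; rewrite -map_comp; apply: (@eq_from_nth _ x0).
  by rewrite size_map size_iota.
rewrite size_map size_iota => i ik.
rewrite (nth_map 0%N) ?size_iota // nth_iota // add0n /= /pick_out.
congr nth; rewrite -{2}(cat_take_drop i a) find_cat ifF; last first.
  apply/hasPn => y yt; rewrite negbK.
  by apply: (subsetP (sub_cl _ _)); rewrite inE.
rewrite (drop_nth x0) ?sa //=.
rewrite (elimT (indep_seqP matM x0 a)) ?sa // addn0.
by rewrite size_take sa ik.
Qed.

Variable S : pred {set 'I_n}.
Hypothesis S_basis : forall A, S A -> A \in M /\ #|A| = k.

Lemma ev_basis_map a (c : k.-tuple 'I_n) :
  indep_seq M a -> size a = k -> S (lset c) ->
  ev (basis_map a (clflag M k c)) c != 0 ->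
  lset c = lset a /\ ev (basis_map a (clflag M k c)) c = 1.
Proof.
move=> ia sa Sc evn0; have ic := S_indep S_basis Sc.
have [uc bn0] := ev_neq0 evn0; have ub := simp_uniq bn0.
have [cE _] := simp_supp bn0.
have ca : lset c = lset a.
  apply/eqP; rewrite eqEcard !card_lset // ?size_tuple ?sa ?leqnn ?andbT;
    last by case/andP: ia.
  rewrite /lset cE; apply/subsetP => y; rewrite !inE => /mapP[F Fc ->].
  have /andP[_ /allP/(_ _ Fc)/andP[_ rF]] := flag_clflag matM ic (size_tuple c).
  by have [] := pick_out_in (has_out ia sa rF).
split=> //; rewrite /basis_map pick_out_clflag ?size_tuple //.
exact: ev_simp.
Qed.

(** All terms are 0 or 1, so nothing cancels, and the term of [a] itself is 1. *)
Lemma flag_trace_basis a : indep_seq M a -> size a = k -> S (lset a) ->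
  flag_trace M k S (basis_map a) != 0.
Proof.
move=> ia sa Sa; rewrite /flag_trace.
have h : size a == k by apply/eqP.
rewrite (bigD1 (Tuple h)) //=; apply: lt0r_neq0; rewrite ltr_pwDl //.
  rewrite /basis_map pick_out_self // ev_simp //.
  by case/andP: ia.
apply: sumr_ge0 => c /andP[Sc _].
have [/(ev_basis_map ia sa Sc)[_ ->]//|] := boolP (ev (basis_map a (clflag M k c)) c != 0).
by rewrite negbK => /eqP ->.
Qed.

Lemma flag_trace_nonbasis a : indep_seq M a -> size a = k -> ~~ S (lset a) ->
  flag_trace M k S (basis_map a) = 0.
Proof.
move=> ia sa Sa; apply: big1 => c Sc; apply/eqP/negPn/negP.
by move=> /(ev_basis_map ia sa Sc)[ca _]; move: Sc; rewrite ca (negbTE Sa).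
Qed.

End Bases.

(** * Nonemptiness and connectedness of the reconfiguration graph *)

Section Connectedness.
Import mathcomp.boot.fintype mathcomp.boot.finset.
Import GRing.Theory Num.Theory Order.TTheory.
Local Open Scope ring_scope.
Variables (n : nat) (C M : {set {set 'I_n}}) (k : nat).
Hypotheses (cC : sc_is_complex C) (matM : sc_is_matroid M) (k_gt0 : (0 < k)%N).
Hypotheses (k_rk : (k <= sc_mrank M)%N) (C0 : set0 \in C).
Hypothesis acycC : flats_acyclic M k C.

Lemma rk_setT : rk M setT = sc_mrank M.
Proof. by congr sc_mrank; apply/setP => A; rewrite inE subsetT andbT. Qed.

Lemma flats_acyclic_full : flats_acyclic M k setT.
Proof.
move=> F p _ rF _; apply: acyc_full; apply: contraTneq rF => F0.
by rewrite -leqNgt -(setCK F) F0 setC0 rk_setT.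
Qed.

(** The independent set [a] need not be a simplex of [C], so the comparison takes place in the full
    simplex, with [S] all independent sets of size k. A nonzero coefficient of [f] then exhibits a
    vertex, since [f] takes values in [C]. *)
Lemma rg_vertex_exists : exists A, sc_rg_vertex C M k A.
Proof.
have [I [IM _ Ie]] := rk_basis matM setT.
pose a := take k (enum I).
have sa : size a = k.
  by rewrite size_take -cardE Ie rk_setT; case: ltngtP k_rk.
have ia : indep_seq M a.
  by apply: indep_take => //; rewrite /indep_seq enum_uniq lset_enum.
have x0 : 'I_n by move: k_gt0; rewrite -sa; case: (a).
have [f mf] := flag_map_exists matM k_gt0 C0 acycC.
have mfT : flag_map M k setT f.
  case: mf => f0 fc fb; split=> // l fl lN0.
  apply: chain_onS (fc l fl lN0); apply/subsetP => s.
  by case: l {fl lN0} => [|F l]; rewrite !inE // => /andP[].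
have mfa : flag_map M k setT (basis_map x0 a).
  by apply: basis_map_flag => // s _; rewrite inE.
pose S A := (A \in M) && (#|A| == k).
have S_basis A : S A -> A \in M /\ #|A| = k by case/andP => ? /eqP.
have S_closed A B : S A -> B \in M -> #|B| = k -> A :|: B \in [set: {set 'I_n}] ->
    #|A :|: B| = k.+1 -> S B by move=> _ BM /eqP Bk _ _; apply/andP.
have tE := flag_trace_eq matM k_gt0 (in_setT set0) flats_acyclic_full x0
  S_basis S_closed mfT mfa.
have : flag_trace M k S f != 0.
  rewrite tE; apply: flag_trace_basis => //; apply/andP.
  by case/andP: ia => ua aM; rewrite card_lset // sa.
move=> tn0; have [c /andP[Sc evn0]] : exists c : k.-tuple 'I_n,
    S (lset c) && (ev (f (clflag M k c)) c != 0).
  apply/existsP; apply: contraNT tn0; rewrite negb_exists => /forallP h.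
  apply/eqP/big1 => c Sc; have := h c; rewrite negb_and Sc /= negbK.
  by move/eqP.
exists (lset c); have [cM ck] := S_basis _ Sc.
rewrite /sc_rg_vertex cM ck eqxx andbT /=.
have ic := S_indep S_basis Sc; have [_ fc _] := mf.
have [_] := ev_neq0 evn0.
move/(fc _ (flag_clflag matM ic (size_tuple c))).
case El: (clflag M k c) => [|F l].
  by have := k_gt0; rewrite -{1}(size_clflag M k c) El.
by move=> /(_ isT) /andP[]; rewrite inE => /andP[].
Qed.

(** If [A] and [B] were not joined, the component of [A] would give the map of [A] a nonzero trace
    and the map of [B] trace 0, against invariance. *)
Lemma rg_connected : sc_rg_connected C M k.
Proof.
split=> [|A B vA vB]; first exact: rg_vertex_exists.
apply/negPn/negP => nAB.
pose S X := sc_rg_vertex C M k X && connect (sc_rg_edge C M k) A X.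
have S_basis X : S X -> X \in M /\ #|X| = k by case/andP => /and3P[? _ /eqP].
have S_closed X Y : S X -> Y \in M -> #|Y| = k -> X :|: Y \in C ->
    #|X :|: Y| = k.+1 -> S Y.
  case/andP => vX AX YM Yk XYC XYk.
  have vY : sc_rg_vertex C M k Y.
    by rewrite /sc_rg_vertex YM Yk eqxx (cC XYC) ?subsetUr.
  rewrite /S vY (connect_trans AX) // connect1 //.
  by rewrite /sc_rg_edge vX vY XYC XYk eqxx.
have vI X : sc_rg_vertex C M k X -> indep_seq M (enum X) /\ size (enum X) = k.
  case/and3P => XM _ /eqP Xk.
  by rewrite /indep_seq enum_uniq lset_enum -cardE.
have [iA sA] := vI _ vA; have [iB sB] := vI _ vB.
have x0 : 'I_n by move: k_gt0; rewrite -sA; case: (enum A).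
have vmap X : sc_rg_vertex C M k X -> flag_map M k C (basis_map x0 (enum X)).
  move=> vX; have [iX sX] := vI _ vX; apply: basis_map_flag => // s.
  by rewrite lset_enum => sX'; case/and3P: vX => _ XC _; apply: cC sX'.
have := flag_trace_eq matM k_gt0 C0 acycC x0 S_basis S_closed (vmap _ vA) (vmap _ vB).
rewrite (flag_trace_nonbasis x0 matM S_basis iB sB); last first.
  by rewrite lset_enum /S (negbTE nAB) andbF.
apply/eqP; apply: flag_trace_basis => //.
by rewrite lset_enum /S vA connect0.
Qed.

End Connectedness.

(** * Barycentric subdivision *)

Section Subdivision.
Import mathcomp.boot.fintype mathcomp.boot.finset.
Import GRing.Theory Num.Theory Order.TTheory.
Import numFieldNormedType.Exports.
Local Open Scope ring_scope.
Variables (R : realType) (E : normedModType R) (W : zmodType).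
Implicit Types (l t m : seq E) (f g w : seq E -> W).

Definition bary l : E := (size l)%:R^-1 *: \sum_(x <- l) x.

(* The value of the cochain [w] on the barycentric subdivision of the affine
   simplex with vertices [l], where [d = size l]. *)
Fixpoint sdI (d : nat) w l : W :=
  if d is d'.+1 then dsum l (fun m => sdI d' (fun t => w (bary l :: t)) m)
  else w [::].

Definition sd w l := sdI (size l) w l.

Lemma eq_sdI d f g l : f =1 g -> sdI d f l = sdI d g l.
Proof.
elim: d f g l => [|d IHd] f g l fg /=; first exact: fg.
by apply: eq_dsum => m _ _; apply: IHd => t; apply: fg.
Qed.

Lemma sdIB d f g l : sdI d (fun t => f t - g t) l = sdI d f l - sdI d g l.
Proof.
elim: d f g l => [//|d IHd] f g l /=; rewrite -dsumB.
by apply: eq_dsum => m _ _; rewrite IHd.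
Qed.

(** Subdivision cones the subdivided boundary from the barycentre. The boundary of a cone is its
    base minus the cone over the boundary of the base, and these last cones cancel by [dsumK]. *)
Lemma sdI_dsum d w l : size l = d ->
  sdI d (fun t => dsum t w) l = dsum l (sdI d.-1 w).
Proof.
elim: d w l => [|d IHd] w l sl /=; first by case: l sl.
transitivity (dsum l (fun m =>
    sdI d w m - dsum m (sdI d.-1 (fun t => w (bary l :: t))))).
  apply: eq_dsum => m _; rewrite sl => -[sm].
  by rewrite -IHd // -sdIB; apply: eq_sdI.
by rewrite dsumB dsumK subr0.
Qed.

Lemma sd_dsum w l : sd (fun t => dsum t w) l = dsum l (sd w).
Proof.
rewrite /sd sdI_dsum //; apply: eq_dsum => m _ sm.
by rewrite -sm.
Qed.

Lemma iter_sd_dsum N w l :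
  iter N sd (fun t => dsum t w) l = dsum l (iter N sd w).
Proof.
elim: N l => [//|N IHN] l /=; rewrite -sd_dsum; exact: eq_sdI.
Qed.

(** Convexity for barycentres only, the sole combinations that subdivision forms. *)
Definition bconvex (H : E -> Prop) :=
  forall l, l != [::] -> (forall x, x \in l -> H x) -> H (bary l).

Lemma bary_sub l b : l != [::] ->
  bary l - b = (size l)%:R^-1 *: \sum_(x <- l) (x - b).
Proof.
move=> l0; rewrite sumrB scalerBr; congr (_ - _).
rewrite big_const_seq count_predT iter_addr_0 -[X in _ *: X]scaler_nat scalerA.
rewrite mulVf ?scale1r //.
by rewrite pnatr_eq0 size_eq0.
Qed.

Lemma bconvex_ball b (r : R) : bconvex (fun x => `|x - b| <= r).
Proof.
move=> l l0 lr; rewrite bary_sub // normrZ ger0_norm ?invr_ge0 //.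
rewrite mulrC ler_pdivrMr ?ltr0n ?lt0n ?size_eq0 //.
apply: le_trans (ler_norm_sum _ _ _) _.
rewrite big_seq; apply: le_trans (_ : \sum_(x <- l | x \in l) r <= _).
  by apply: ler_sum => x /lr.
by rewrite -big_seq big_const_seq count_predT iter_addr_0 mulr_natr.
Qed.

(** In the average of the differences x - v, the term of [v] itself is 0, which leaves size l - 1
    terms out of size l. *)
Lemma bary_dist l v (r : R) : v \in l -> 
  (forall x, x \in l -> `|x - v| <= r) ->
  `|bary l - v| <= (1 - (size l)%:R^-1) * r.
Proof.
move=> vl lr; have l0 : l != [::] by case: (l) vl.
have sl : (0 : R) < (size l)%:R by rewrite ltr0n lt0n size_eq0.
rewrite bary_sub // normrZ ger0_norm ?invr_ge0 ?(ltW sl) //.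
have -> : 1 - (size l)%:R^-1 = (size l)%:R^-1 * ((size l).-1)%:R :> R.
  apply: (mulfI (lt0r_neq0 sl)); rewrite mulrA mulfV ?lt0r_neq0 // mul1r mulrBr mulr1.
  by rewrite mulfV ?lt0r_neq0 // -[in LHS](@prednK (size l)) ?lt0n ?size_eq0 // -natr1 addrK.
rewrite -mulrA ler_pM2l ?invr_gt0 //.
rewrite (big_rem v vl) /= subrr add0r.
apply: le_trans (ler_norm_sum _ _ _) _.
rewrite big_seq; apply: le_trans (_ : \sum_(x <- rem v l | x \in rem v l) r <= _).
  by apply: ler_sum => x /mem_rem /lr.
by rewrite -big_seq big_const_seq count_predT iter_addr_0 size_rem // mulr_natl.
Qed.

Definition meshed (H : E -> Prop) (r : R) t :=
  (forall x, x \in t -> H x) /\ (forall x y, x \in t -> y \in t -> `|x - y| <= r).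

(** Edges at the barycentre are short by [bary_dist], the others by induction. [H] varies so that it
    can absorb the ball of radius [q] about the barycentre; the ratio 1 - 1/(k+1) is the worst one
    for at most k + 1 vertices. *)
Lemma sdI_closed (P : W -> Prop) (H : E -> Prop) (k d : nat) (r : R) w l :
  P 0 -> (forall a b, P a -> P b -> P (a - b)) -> bconvex H ->
  0 <= r -> size l = d -> (d <= k.+1)%N -> meshed H r l ->
  (forall t, size t = d -> meshed H ((1 - k.+1%:R^-1) * r) t -> P (w t)) ->
  P (sdI d w l).
Proof.
move=> P0 PB + r0; elim: d H w l => [|d IHd] H w l cH sl dk [Hl rl] Pw /=.
  by apply: Pw.
set q := (1 - _) * r in Pw.
have q0 : 0 <= q by rewrite mulr_ge0 // subr_ge0 invf_le1 ?ler1n ?ltr0n.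
apply: dsum_closed => // m ml; rewrite sl => -[sm].
apply: (IHd (fun x => H x /\ `|x - bary l| <= q)) => //.
- move=> t t0 Ht; split; first by apply: cH => // x /Ht[].
  by apply: bconvex_ball => // x /Ht[].
- exact: ltnW.
- split=> [x xm|x y xm ym]; last by apply: rl; apply: (mem_subseq ml).
  have xl := mem_subseq ml xm; split; first exact: Hl.
  rewrite distrC; apply: le_trans (bary_dist xl _) _.
    by move=> y yl; apply: rl.
  apply: ler_wpM2r => //; rewrite lerD2l lerN2 lef_pV2 ?posrE ?ltr0n // ?sl //.
  by rewrite ler_nat.
move=> t st [Ht rt]; apply: Pw; first by rewrite /= st.
have bt x : x \in t -> `|x - bary l| <= q by case/Ht.
split=> [x|x y]; rewrite !inE.
  case/orP => [/eqP->|/Ht[] //]; apply: cH => //.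
  by rewrite -size_eq0 sl.
case/orP => [/eqP->|xt] /orP[/eqP->|yt].
- by rewrite subrr normr0.
- by rewrite distrC; apply: bt.
- exact: bt.
- exact: rt.
Qed.

Lemma iter_sd_closed (P : W -> Prop) (H : E -> Prop) (k N : nat) (r : R) w l :
  P 0 -> (forall a b, P a -> P b -> P (a - b)) -> bconvex H ->
  0 <= r -> (size l <= k.+1)%N -> meshed H r l ->
  (forall t, size t = size l -> meshed H ((1 - k.+1%:R^-1) ^+ N * r) t -> P (w t)) ->
  P (iter N sd w l).
Proof.
move=> P0 PB cH; elim: N r l => [|N IHN] r l r0 sl ml Pw /=.
  by apply: Pw; rewrite // expr0 mul1r.
apply: (@sdI_closed P H k (size l) r) => // t st mt.
apply: IHN mt _ => [||t' st' mt'].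
- by rewrite mulr_ge0 // subr_ge0 invf_le1 ?ler1n ?ltr0n.
- by rewrite st.
by apply: Pw; rewrite ?st' // exprSr -mulrA.
Qed.

End Subdivision.

Lemma raddf_sdI (R : realType) (E : normedModType R) (V W : zmodType)
    (f : {additive V -> W}) d (w : seq E -> V) l :
  f (sdI d w l) = sdI d (fun t => f (w t)) l.
Proof.
elim: d w l => [//|d IHd] w l /=; rewrite raddf_dsum.
by apply: eq_dsum => m _ _; apply: IHd.
Qed.

Lemma raddf_iter_sd (R : realType) (E : normedModType R) (V W : zmodType)
    (f : {additive V -> W}) N (w : seq E -> V) l :
  f (iter N (@sd _ _ _) w l) = iter N (@sd _ _ _) (fun t => f (w t)) l.
Proof.
elim: N l => [//|N IHN] l /=; rewrite /sd raddf_sdI.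
by apply: eq_sdI => t; apply: IHN.
Qed.

(** * Chains as combinations of increasingly ordered simplices *)

Section EnumChains.
Import mathcomp.boot.fintype mathcomp.boot.finset.
Import GRing.Theory Num.Theory Order.TTheory.
Local Open Scope ring_scope.
Variable n : nat.
Notation chain := {ffun {set 'I_n} -> rat}.
Implicit Types (c x : chain) (s t : {set 'I_n}) (q : rat) (l m : seq 'I_n).

Lemma scal0 x : scal 0 x = 0.
Proof. exact: (raddf0 (scalr x)). Qed.

Lemma bd_scal q x : bd (scal q x) = scal q (bd x).
Proof.
apply/ffunP => t; rewrite [RHS]ffunE /bd !sum_ffunE mulr_sumr.
apply: eq_bigr => v _; rewrite !ffunE; case: ifP => _; first by rewrite mulr0.
by rewrite mulrCA.
Qed.

Lemma simp_sq l : uniq l -> simp l (lset l) * simp l (lset l) = 1.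
Proof.
elim: l => [|v l IHl] /=; first by rewrite lset_nil !ffunE eqxx mulr1.
case/andP => vl ul; rewrite lset_cons ffunE !inE eqxx /= setU1K ?inE //.
by rewrite mulrACA -expr2 sqrr_sign mul1r IHl.
Qed.

Lemma simp_sq_enum s : simp (enum s) s * simp (enum s) s = 1.
Proof. by have := simp_sq (enum_uniq s); rewrite lset_enum. Qed.

Lemma simp_enumE s t : simp (enum s) t = if t == s then simp (enum s) s else 0.
Proof.
case: eqVneq => [->//|ts]; apply/eqP/negPn/negP => /simp_supp[tE _].
by move: ts; rewrite tE -/(lset _) lset_enum eqxx.
Qed.

(** The factor [simp (enum s) s] is a sign, hence its own inverse. *)
Definition enum_coef c s := c s * simp (enum s) s.

Lemma enum_decomp c : c = \sum_s scal (enum_coef c s) (simp (enum s)).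
Proof.
apply/ffunP => t; rewrite sum_ffunE (bigD1 t) //= big1 ?addr0 => [|s st].
  by rewrite ffunE -mulrA simp_sq_enum mulr1.
by rewrite ffunE simp_enumE eq_sym (negbTE st) mulr0.
Qed.

Lemma enum_lset m s : subseq m (enum s) -> enum (lset m) = m.
Proof.
move=> ms; have um := subseq_uniq ms (enum_uniq _).
have sub : subseq m (enum 'I_n).
  apply: subseq_trans ms _; rewrite {1}/enum_mem enumT; exact: filter_subseq.
have /(subseq_uniqP (enum_uniq _)) {2}-> := sub.
rewrite [LHS]/enum_mem -enumT; apply: eq_filter => y /=.
by rewrite inE.
Qed.

Lemma dsum_sum (X : eqType) (V : zmodType) (I : finType) (r : seq X)
    (F : I -> seq X -> V) :
  dsum r (fun r' => \sum_i F i r') = \sum_i dsum r (F i).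
Proof.
elim: r F => [|x r IHr] F /=; first by rewrite big1.
by rewrite IHr -sumrB.
Qed.

(** The incidence number of [t] in [s], both ordered increasingly. *)
Definition face_coef s t : rat := dsum (enum s) (fun m => (enum t == m)%:R).

Lemma dsum_enum s (G : seq 'I_n -> chain) :
  dsum (enum s) G = \sum_t scal (face_coef s t) (G (enum t)).
Proof.
transitivity (\sum_(t : {set 'I_n})
    dsum (enum s) (fun m => scalr (G (enum t)) (enum t == m)%:R)).
  rewrite -dsum_sum; apply: eq_dsum => m ms _.
  rewrite (bigD1 (lset m)) //= big1 ?addr0 => [|t tm].
    by apply/ffunP => u; rewrite (enum_lset ms) eqxx ffunE mul1r.
  have /negbTE -> : enum t != m.
    by apply: contraNneq tm => <-; rewrite lset_enum.
  exact: raddf0.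
by apply: eq_bigr => t _; rewrite -raddf_dsum.
Qed.

(** Collecting terms by faces gives coefficients [a t] independent of [G]. For G = [simp] the sum is
    bd c = 0, which forces every [a t] to vanish. *)
Lemma cycle_dsum c (G : seq 'I_n -> chain) : bd c = 0 ->
  \sum_s scal (enum_coef c s) (dsum (enum s) G) = 0.
Proof.
pose a t := \sum_s enum_coef c s * face_coef s t.
have aE (H : seq 'I_n -> chain) :
    \sum_s scal (enum_coef c s) (dsum (enum s) H) = \sum_t scal (a t) (H (enum t)).
  under eq_bigr do rewrite dsum_enum raddf_sum /=.
  rewrite exchange_big /=; apply: eq_bigr => t _; apply/ffunP => u.
  rewrite sum_ffunE [RHS]ffunE mulr_suml; apply: eq_bigr => s _.
  by rewrite !ffunE mulrA.
move=> bc; rewrite aE big1 // => t _.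
suff -> : a t = 0 by exact: (raddf0 (scalr _)).
have : bd (\sum_s scal (enum_coef c s) (simp (enum s))) t = 0.
  by rewrite -enum_decomp bc ffunE.
rewrite raddf_sum /=; under eq_bigr do rewrite bd_scal bd_simp.
rewrite aE sum_ffunE (bigD1 t) //= big1 ?addr0 => [|s st]; last first.
  by rewrite ffunE simp_enumE eq_sym (negbTE st) mulr0.
rewrite ffunE => e; by rewrite -[a t]mulr1 -(simp_sq_enum t) mulrA e mul0r.
Qed.

(** The value of [bd c] at the facet [s :\ v] is the value of [c] at [s] up to sign. *)
Lemma single_cycle0 c s : s != set0 -> (forall t, c t != 0 -> t = s) ->
  bd c = 0 -> c = 0.
Proof.
case/set0Pn => v vs cs bc; apply/ffunP => t; rewrite [RHS]ffunE.
apply/eqP/negPn/negP => /[dup] ct /cs ts; rewrite {}ts in ct.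
have : bd c (s :\ v) = 0 by rewrite bc ffunE.
rewrite /bd sum_ffunE (bigD1 v) //= big1 ?addr0 => [|w wv].
  rewrite ffunE !inE eqxx /= setD1K // => /eqP.
  by rewrite mulf_eq0 (negbTE ct) orbF signr_eq0.
rewrite ffunE !inE wv /=; case: ifP => // ws.
apply/eqP/negPn/negP; rewrite mulf_eq0 negb_or => /andP[_ /cs e].
by have := vs; rewrite -e !inE eqxx (negbTE (_ : v != w)) // eq_sym.
Qed.

End EnumChains.

(** * Acyclicity from a Sperner-type labelling *)

Section Labeling.
Import mathcomp.boot.fintype mathcomp.boot.finset.
Import GRing.Theory Num.Theory Order.TTheory.
Import numFieldNormedType.Exports.
Local Open Scope ring_scope.
Variables (R : realType) (n : nat).
Notation E := 'rV[R]_n.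

Definition face (s : {set 'I_n}) (x : E) : Prop :=
  [/\ forall i, 0 <= x ord0 i, \sum_i x ord0 i = 1 &
      forall i, i \notin s -> x ord0 i = 0].

Definition vtx (v : 'I_n) : E := delta_mx ord0 v.

Lemma face_vtx (s : {set 'I_n}) v : v \in s -> face s (vtx v).
Proof.
move=> vs; split=> [i||i ns].
- by rewrite mxE; case: (_ && _).
- rewrite (bigD1 v) //= big1 ?addr0 ?mxE ?eqxx // => i iv.
  by rewrite mxE (negbTE iv) andbF.
by rewrite mxE; case: (eqVneq i v) => [iv|_]; [rewrite iv vs in ns | rewrite andbF].
Qed.

Lemma bary_coord (l : seq E) i :
  bary l ord0 i = (size l)%:R^-1 * \sum_(x <- l) x ord0 i.
Proof. by rewrite /bary mxE summxE. Qed.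

Lemma bconvex_face s : bconvex (face s).
Proof.
move=> l l0 lf; have sl : (size l)%:R != 0 :> R by rewrite pnatr_eq0 size_eq0.
split=> [i||i ns].
- rewrite bary_coord mulr_ge0 ?invr_ge0 // big_seq; apply: sumr_ge0 => x /lf[h _ _].
  exact: h.
- under eq_bigr do rewrite bary_coord.
  rewrite -mulr_sumr exchange_big /= big_seq.
  under eq_bigr => x xl do (have [_ -> _] := lf _ xl).
  by rewrite -big_seq big_const_seq count_predT iter_addr_0 mulVf.
rewrite bary_coord big_seq big1 ?mulr0 // => x /lf[_ _ h].
exact: h.
Qed.

Variables (K : {set {set 'I_n}}) (p : nat) (v0 : 'I_n).
Hypothesis cK : sc_is_complex K.
Variables (phi : E -> 'I_n) (delta : R).
Hypothesis delta_gt0 : 0 < delta.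
Hypothesis phi_face : forall (s : {set 'I_n}) x, s \in K -> face s x -> phi x \in s.
Hypothesis phi_mesh : forall (s : {set 'I_n}) (t : seq E), (#|s| <= p.+1)%N ->
  t != [::] -> meshed (face s) delta t -> lset (map phi t) \in K.

Let B : R := \sum_v `|vtx v|.

Let vtx_dist v w : `|vtx v - vtx w| <= B + B.
Proof.
apply: le_trans (ler_normB _ _) _.
have le u : `|vtx u| <= B.
  by rewrite /B (bigD1 u) //= lerDl sumr_ge0.
exact: lerD.
Qed.

Let kappa : R := 1 - p.+1%:R^-1.

Let mesh_N : exists N, kappa ^+ N * (B + B) <= delta.
Proof.
have k0 : 0 <= kappa by rewrite subr_ge0 invf_le1 ?ler1n ?ltr0n.
have k1 : `|kappa| < 1 by rewrite ger0_norm // ltrBlDr ltrDl invr_gt0 ltr0n.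
have B0 : 0 <= B + B by rewrite addr_ge0 // sumr_ge0.
(* The added 1 makes the denominator positive without a lower bound on [B]. *)
have e0 : 0 < delta / (B + B + 1) by rewrite divr_gt0 // ltr_wpDl.
have /cvgr0Pnorm_lt/(_ _ e0)[N _ /(_ N (leqnn N))] := cvg_expr k1.
rewrite /= ger0_norm ?exprn_ge0 // => h; exists N.
rewrite ltr_pdivlMr ?ltr_wpDl // in h.
apply: ltW; apply: le_lt_trans h; apply: ler_wpM2l; first exact: exprn_ge0.
by rewrite lerDl.
Qed.

(** [T l] is the label image of the N-fold subdivision of [l]. It commutes with boundaries, fixes
    the simplices of [K] with at most p + 1 vertices by [phi_face], and has values in [K] on p + 1
    vertices by [phi_mesh]. *)
Lemma acyc_of_labeling : acyc K p.
Proof.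
have [N hN] := mesh_N.
pose w (t : seq E) := simp (map phi t).
pose T (l : seq 'I_n) := iter N (@sd R E _) w (map vtx l).
have bdT l : bd (T l) = dsum l T.
  have bw : (fun t => bd (w t)) = (fun t => dsum t w).
    by apply/funext => t; rewrite /w bd_simp dsum_map.
  have bE : bd (T l) = iter N (@sd R E _) (fun t => bd (w t)) (map vtx l).
    exact: (raddf_iter_sd (@bd n)).
  by rewrite bE bw iter_sd_dsum dsum_map.
have T_ind (P : {ffun {set 'I_n} -> rat} -> Prop) l (s : {set 'I_n}) :
    P 0 -> (forall a b, P a -> P b -> P (a - b)) -> (size l <= p.+1)%N ->
    {subset l <= s} ->
    (forall t, size t = size l -> meshed (face s) delta t -> P (w t)) -> P (T l).
  move=> P0 PB sl ls Pw.
  apply: (@iter_sd_closed _ _ _ P (face s) p N (B + B)) => //.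
  - exact: bconvex_face.
  - by rewrite addr_ge0 // sumr_ge0.
  - by rewrite size_map.
  - split=> [_ /mapP[v vl ->]|_ _ /mapP[v _ ->] /mapP[v' _ ->]].
      exact/face_vtx/ls.
    exact: vtx_dist.
  move=> t; rewrite size_map => st [tf tr]; apply: Pw => //; split=> // x y xt yt.
  exact: le_trans (tr x y xt yt) hN.
have T_on l : size l = p.+1 -> sc_chain_on K p.+1 (T l).
  move=> sl; apply: (T_ind (sc_chain_on K p.+1) l (lset l)).
  - exact: chain_on0.
  - exact: chain_onB.
  - by rewrite sl.
  - by move=> v vl; rewrite inE.
  move=> t st mt s /simp_supp[-> ->]; rewrite size_map st sl eqxx andbT.
  apply: phi_mesh mt; last by rewrite -size_eq0 st sl.
  rewrite -sl; apply: leq_trans (card_size l).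
  by rewrite subset_leq_card //; apply/subsetP => y; rewrite inE.
(* By induction on faces, [T l] - [simp l] is a cycle; labels stay in the face, so it is supported
   on the top simplex and is 0. *)
have T_self l : uniq l -> lset l \in K -> (size l <= p.+1)%N -> T l = simp l.
  have [d] := ubnP (size l); elim: d l => // d IHd l ld ul lK sl.
  case: l => [|v l] in ld ul lK sl *.
    by rewrite /T; elim: (N) => [//|N' IHN]; rewrite iterS /sd /= in IHN *.
  have TE : dsum (v :: l) T = dsum (v :: l) (@simp n).
    apply: eq_dsum => m ml sm; apply: IHd.
    - by rewrite -ltnS sm.
    - exact: subseq_uniq ul.
    - apply: cK lK _; apply/subsetP => y; rewrite !inE => /(mem_subseq ml).
      by rewrite inE.
    - by apply: leq_trans sl; rewrite -sm.
  apply/eqP; rewrite -subr_eq0; apply/eqP.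
  apply: (@single_cycle0 _ _ (lset (v :: l))); last first.
  - by rewrite bdB bdT bd_simp TE subrr.
  - have sub0 (c c' : {ffun {set 'I_n} -> rat}) :
        (forall t, c t != 0 -> t = lset (v :: l)) ->
        (forall t, c' t != 0 -> t = lset (v :: l)) ->
        forall t, (c - c') t != 0 -> t = lset (v :: l).
      move=> h h' t; have [/h//|] := boolP (c t != 0).
      rewrite negbK => /eqP c0; have [/h'//|] := boolP (c' t != 0).
      by rewrite negbK => /eqP c'0; rewrite !ffunE c0 c'0 subrr eqxx.
    apply: (sub0); last by move=> t /simp_supp[].
    apply: (T_ind (fun c => forall t, c t != 0 -> t = lset (v :: l)) _ (lset (v :: l))).
    + by move=> t; rewrite ffunE eqxx.
    + exact: sub0.
    + exact: sl.
    + by move=> y yl; rewrite inE.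
    move=> t st [tf _] s /simp_supp[sE sc]; apply/eqP.
    rewrite eqEcard sc size_map st card_lset // leqnn andbT.
    apply/subsetP => y; rewrite sE inE => /mapP[x xt ->].
    exact: phi_face (tf _ xt).
  by apply/set0Pn; exists v; rewrite inE mem_head.
move=> c cc bc.
have coefN0 s : enum_coef c s != 0 -> s \in K /\ #|s| = p.
  by rewrite mulf_eq0 negb_or => /andP[/cc/andP[? /eqP]].
(* The cone over [c] with apex [v0], which need not be a vertex of [K]: only the labels have to span
   simplices of [K]. *)
exists (\sum_s scal (enum_coef c s) (T (v0 :: enum s))).
  elim/big_ind: _ => [|x y cx cy|s _].
  - exact: chain_on0.
  - rewrite -[y]opprK; apply: chain_onB => //; rewrite -sub0r.
    by apply: chain_onB => //; apply: chain_on0.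
  move=> t; rewrite ffunE mulf_eq0 negb_or => /andP[/coefN0[_ sp]].
  by apply: T_on; rewrite /= -cardE sp.
rewrite raddf_sum /=.
(* The bases of the cones add up to [c]; their sides add up to 0 by [cycle_dsum]. *)
transitivity (\sum_s (scal (enum_coef c s) (simp (enum s)) -
  scal (enum_coef c s) (dsum (enum s) (fun m => T (v0 :: m))))).
  apply: eq_bigr => s _; rewrite bd_scal bdT /= raddfB /=.
  have [/coefN0[sK sp]|] := boolP (enum_coef c s != 0).
    rewrite T_self ?enum_uniq ?lset_enum -?cardE ?sp //.
  by rewrite negbK => /eqP ->; rewrite !scal0.
by rewrite sumrB -enum_decomp cycle_dsum // subr0.
Qed.

End Labeling.

(** * Extension of maps over a skeleton *)

Section Continuity.
Import GRing.Theory Num.Theory Order.TTheory.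
Import numFieldNormedType.Exports.
Local Open Scope classical_set_scope.
Local Open Scope ring_scope.

Lemma within_comp (T U V : topologicalType) (A : set T) (B : set U)
    (f : T -> U) (g : U -> V) :
  (forall x, A x -> B (f x)) ->
  {within A, continuous f} -> {within B, continuous g} ->
  {within A, continuous (g \o f)}.
Proof.
move=> AB /subspace_continuousP cf /subspace_continuousP cg.
apply/subspace_continuousP => x Ax.
apply: (@cvg_comp _ _ _ f g _ (within B (nbhs (f x)))); last exact/cg/AB.
move=> Q /(cf x Ax) /= h; have {}h : within A (nbhs x) (fun y => B (f y) -> Q (f y)) by [].
by apply: filterS2 h (withinT _ _) => y h /AB; apply: h.
Qed.

Lemma eq_within (T U : topologicalType) (A : set T) (f g : T -> U) :
  (forall x, A x -> f x = g x) ->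
  {within A, continuous f} -> {within A, continuous g}.
Proof.
move=> fg /subspace_continuousP cf; apply/subspace_continuousP => x Ax.
move=> Q gQ; have /(cf x Ax) h : nbhs (f x) Q by rewrite fg.
have {}h : within A (nbhs x) (fun y => Q (f y)) by [].
suff : within A (nbhs x) (fun y => Q (g y)) by [].
by apply: filterS2 h (withinT _ _) => y /= h /fg <-.
Qed.

Lemma continuous_at_within (T U : topologicalType) (A : set T) (f : T -> U) :
  (forall x, A x -> f @ x --> f x) -> {within A, continuous f}.
Proof.
move=> cf; apply/subspace_continuousP => x Ax.
exact: cvg_within_filter (cf x Ax).
Qed.

Lemma within_bigU (T U : topologicalType) (I : eqType) (r : seq I)
    (A : I -> set T) (f : T -> U) :
  (forall i, i \in r -> closed (A i)) ->
  (forall i, i \in r -> {within A i, continuous f}) ->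
  {within [set x | exists2 i, i \in r & A i x], continuous f}.
Proof.
move=> cA cf.
suff [] : closed [set x | exists2 i, i \in r & A i x] /\
  {within [set x | exists2 i, i \in r & A i x], continuous f} by [].
elim: r cA cf => [|i r IHr] cA cf.
  have -> : [set x | exists2 i, i \in [::] & A i x] = set0.
    by apply/seteqP; split => // x [].
  by split; [apply: closed0 | apply: continuous_subspace0].
have -> : [set x | exists2 i0, i0 \in i :: r & A i0 x] =
    A i `|` [set x | exists2 i, i \in r & A i x].
  apply/seteqP; split => x.
    by case=> k; rewrite inE => /orP[/eqP->|kr] Ax; [left|right; exists k].
  by case=> [Ax|[k kr Ax]]; [exists i|exists k]; rewrite ?inE ?eqxx ?kr ?orbT.
have [cr fr] : closed [set x | exists2 i, i \in r & A i x] /\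
    {within [set x | exists2 i, i \in r & A i x], continuous f}.
  by apply: IHr => k kr; [apply: cA|apply: cf]; rewrite inE kr orbT.
split; first by apply: closedU => //; apply: cA; rewrite mem_head.
by apply: withinU_continuous => //; [apply: cA|apply: cf]; rewrite mem_head.
Qed.

(** Stated for a general operation, to serve sums, products and minima alike. *)
Lemma cvg_bigop (R : realType) (T : topologicalType) (I : Type) (r : seq I)
    (P : pred I) (op : R -> R -> R) (idx : R) (F : I -> T -> R) (x : T) :
  (forall f g : T -> R, f @ x --> f x -> g @ x --> g x ->
     (fun t => op (f t) (g t)) @ x --> op (f x) (g x)) ->
  (forall i, P i -> F i @ x --> F i x) ->
  (fun t => \big[op/idx]_(i <- r | P i) F i t) @ x -->
  \big[op/idx]_(i <- r | P i) F i x.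
Proof.
move=> cop cF; elim: r => [|i r IHr].
  by under eq_fun do rewrite big_nil; rewrite big_nil; apply: cvg_cst.
under eq_fun do rewrite big_cons; rewrite big_cons.
case: ifP => Pi; last exact: IHr.
exact: (cop (F i) (fun t => \big[op/idx]_(i <- r | P i) F i t) (cF i Pi) IHr).
Qed.

Lemma cvg_row (R : realType) (T : topologicalType) (m : nat)
    (F : T -> 'rV[R]_m) (x : T) :
  (forall i, (fun t => F t ord0 i) @ x --> F x ord0 i) -> F @ x --> F x.
Proof.
move=> cF; apply/cvg_ballP => e e0.
have h : forall i : 'I_m, \forall t \near x, ball (F x ord0 i) e (F t ord0 i).
  by move=> i; move/cvg_ballP: (cF i); apply.
apply: (@filterS _ _ _ _ _ _ (filter_forall _ h)) => t ht; split=> // i j.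
by rewrite (ord1 i); apply: ht.
Qed.

Lemma row_dist_coord (R : realType) (m : nat) (x y : 'rV[R]_m) (e : R) i :
  `|x - y| < e -> `|x ord0 i - y ord0 i| < e.
Proof.
move=> xy; have : ball x e y by rewrite -ball_normE.
by case=> _ /(_ ord0 i); rewrite -ball_normE.
Qed.

(** Heine-Cantor: near each point one radius serves all nearby centres, and compactness in
    near-covering form makes it uniform. *)
Lemma compact_unif (R : realType) (U V : normedModType R) (A : set U)
    (f : U -> V) (e : R) : 0 < e -> compact A -> {within A, continuous f} ->
  exists2 d, 0 < d & forall x y, A x -> A y -> `|x - y| < d -> `|f x - f y| < e.
Proof.
move=> e0 /compact_near_coveringP cA /subspace_continuousP cf.
pose P (d : R) (x : U) :=
  A x -> forall y, A y -> `|x - y| < d -> `|f x - f y| < e.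
have hP : \forall d \near (0 : R)^'+, A `<=` P d.
  apply: cA => x Ax.
  have e2 : 0 < e / 2 by rewrite divr_gt0.
  have /cvgrPdist_lt/(_ _ e2) := cf x Ax.
  case/nbhs_ballP => d /= d0 dP.
  have d2 : 0 < d / 2 by rewrite divr_gt0.
  exists (ball x (d / 2), [set t | t < d / 2]).
    by split; [apply: nbhsx_ballx | apply: nbhs_right_lt].
  move=> [x' t] /= [xx' td] Ax' y Ay x'y.
  have xd : ball x d x' by apply: le_ball xx'; lra.
  have yd : ball x d y.
    rewrite -ball_normE /= in xx' *.
    rewrite -(subrKA x') (splitr d); apply: le_lt_trans (ler_normD _ _) _.
    by rewrite ltrD // (lt_trans x'y).
  rewrite -(subrKA (f x)) (splitr e); apply: le_lt_trans (ler_normD _ _) _.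
  by rewrite ltrD //; [rewrite distrC|]; apply: dP.
have [d [/= d0 dP]] := filter_ex (filterI (nbhs_right_gt (0 : R)) hP).
by exists d => // x y Ax Ay; apply: (dP x Ax Ax y Ay).
Qed.

End Continuity.

(** * Faces of the standard simplex and maps defined on them *)

Section Faces.
Import mathcomp.boot.fintype mathcomp.boot.finset.
Import GRing.Theory Num.Theory Order.TTheory.
Import numFieldNormedType.Exports.
Local Open Scope ring_scope.
Variables (R : realType) (n : nat).
Notation E := 'rV[R]_n.
Implicit Types (s : {set 'I_n}) (x : E).

Lemma cvg_coord m (i : 'I_m) (x : 'rV[R]_m) :
  ((fun z : 'rV[R]_m => z ord0 i) @ x --> x ord0 i)%classic.
Proof. exact: coord_continuous. Qed.

Lemma closed_face s : closed (face s : set E).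
Proof.
have cc i := @coord_continuous R 1 n ord0 i.
have -> : (face s : set E) = ((\bigcap_(i in [set: 'I_n]) [set x : E | 0 <= x ord0 i])
   `&` [set x : E | (\sum_i x ord0 i)%R = 1]
   `&` \bigcap_(i in [set i | i \notin s]) [set x : E | x ord0 i = 0])%classic.
  apply/seteqP; split=> x.
    by case=> x0 x1 xs; apply: (conj (conj (fun i _ => x0 i) x1) xs).
  by case=> -[x0 x1] xs; apply: (And3 (fun i => x0 i I) x1 xs).
apply: closedI; first apply: closedI.
- apply: closed_bigI => i _.
  exact: (continuous_closedP _).1 (cc i) _ (@closed_ge R 0).
- have cs : continuous (fun x : E => \sum_i x ord0 i).
    move=> x; apply: (@cvg_bigop R _ _ _ _ _ _ (fun i (t : E) => t ord0 i)).
      by move=> f g cf cg; apply: (cvgD cf cg).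
    by move=> i _; apply: cc.
  exact: (continuous_closedP _).1 cs _ (@closed_eq R 1).
- apply: closed_bigI => i _.
  exact: (continuous_closedP _).1 (cc i) _ (@closed_eq R 0).
Qed.

Lemma face_le1 s x i : face s x -> 0 <= x ord0 i <= 1.
Proof.
case=> x0 x1 _; rewrite x0 -x1 (bigD1 i) //= lerDl.
by apply: sumr_ge0.
Qed.

Lemma compact_face s : compact (face s : set E).
Proof.
have cI : compact [set x : E | forall i, (`[0 : R, 1]%classic) (x ord0 i)]%classic.
  exact: (@rV_compact R n (fun=> `[0 : R, 1]%classic) (fun=> @segment_compact R 0 1)).
apply: subclosed_compact (@closed_face s) cI _ => x fx i.
by rewrite /= in_itv /=; apply: face_le1 fx.
Qed.

Definition supp x : {set 'I_n} := [set i | x ord0 i != 0].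

Lemma face_supp s x : face s x -> supp x \subset s /\ face (supp x) x.
Proof.
case=> x0 x1 xs; split.
  by apply/subsetP => i; rewrite inE; apply: contraR => /xs ->.
by split=> // i; rewrite inE negbK => /eqP.
Qed.

Lemma supp_realization (K : {set {set 'I_n}}) s x :
  face s x -> supp x \in K -> sc_realization R K x.
Proof. by case=> x0 x1 _ xK; split. Qed.

Definition boundary s : set E :=
  [set x | face s x /\ exists2 u, u \in s & x ord0 u = 0]%classic.

Section Extension.
Variables (K : {set {set 'I_n}}) (s : {set 'I_n}) (v1 : 'I_n).
Hypothesis v1s : v1 \in s.

(* In the coordinates [y], which vanish exactly at the barycentre of [s], [h] maps
   [face s] to the unit ball and its boundary to the sphere by radial projection;
   [X] inverts that projection. The product [q] vanishes exactly on the boundary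
   and keeps the denominator of [h] positive. *)
Let j := #|s :\ v1|.
Let e : 'I_j -> 'I_n := @enum_val _ (mem (s :\ v1)).
Let N2 (z : 'rV[R]_j) : R := \sum_i z ord0 i ^+ 2.
Let y x : 'rV[R]_j := \row_i (x ord0 (e i) - x ord0 v1).
Let q x : R := \prod_(v in s) x ord0 v.
Let den x := Num.sqrt (N2 (y x)) + q x.
Let h x := (den x)^-1 *: y x.
Let Zv (z : 'rV[R]_j) v : R := \sum_i z ord0 i * (e i == v)%:R.
Let m z : R := \big[Num.min/0]_(v in s) Zv z v.
Let D z : R := \sum_(v in s) (Zv z v - m z).
Let X z : E := \row_v (if v \in s then (Zv z v - m z) / D z else 0).

Let e_in i : e i \in s :\ v1. Proof. exact: enum_valP. Qed.
Let e_s i : e i \in s. Proof. by have := e_in i; rewrite inE => /andP[]. Qed.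

Let Zv_e z i : Zv z (e i) = z ord0 i.
Proof.
rewrite /Zv (bigD1 i) //= big1 ?addr0 ?eqxx ?mulr1 // => k ki.
by rewrite (inj_eq enum_val_inj) (negbTE ki) mulr0.
Qed.

Let Zv_v1 z : Zv z v1 = 0.
Proof.
rewrite /Zv big1 // => i _; have := e_in i; rewrite !inE => /andP[/negbTE -> _].
by rewrite mulr0.
Qed.

Let s_cases v : v \in s -> v = v1 \/ exists i, v = e i.
Proof.
move=> vs; case: (eqVneq v v1) => [->|vv]; [by left|right].
have vin : v \in s :\ v1 by rewrite !inE vv.
by exists (enum_rank_in vin v); rewrite /e enum_rankK_in.
Qed.

Let m_le z v : v \in s -> m z <= Zv z v.
Proof. by move=> vs; apply: bigmin_le_cond. Qed.

(** The initial value 0 of the minimum is attained too, at [v1]. *)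
Let m_att z : exists2 v, v \in s & m z = Zv z v.
Proof.
rewrite /m; elim/big_ind: _ => [|a b [v vs ->] [w ws ->]|v vs].
- by exists v1; rewrite ?Zv_v1.
- by rewrite /Num.min; case: ifP => _; [exists v|exists w].
- by exists v.
Qed.

Let D_ge0 z v : v \in s -> 0 <= Zv z v - m z.
Proof. by move=> vs; rewrite subr_ge0 m_le. Qed.

(** If D = 0, all [Zv z v] equal the minimum, which is 0 because of [v1]; then z = 0. *)
Let D_gt0 z : N2 z = 1 -> 0 < D z.
Proof.
move=> z1; rewrite lt0r sumr_ge0 ?andbT => [|v /D_ge0//].
apply/eqP => /psumr_eq0P D0.
have m0 : m z = 0.
  have := D0 (fun v vs => D_ge0 z vs) v1 v1s.
  by rewrite Zv_v1 sub0r => /eqP; rewrite oppr_eq0 => /eqP.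
have z0 i : z ord0 i = 0.
  have := D0 (fun v vs => D_ge0 z vs) (e i) (e_s i).
  by rewrite Zv_e m0 subr0.
move: z1; rewrite /N2 big1 => [/eqP|i _]; first by rewrite eq_sym oner_eq0.
by rewrite z0 expr0n.
Qed.

Let X_boundary z : N2 z = 1 -> boundary s (X z).
Proof.
move=> /D_gt0 D0; split.
  split=> [v||v vs]; rewrite ?mxE ?(negbTE vs) //.
    by case: ifP => // vs; rewrite divr_ge0 ?D_ge0 // ltW.
  under eq_bigr do rewrite mxE.
  by rewrite -big_mkcond /= -mulr_suml divff // gt_eqF.
by have [v vs mE] := m_att z; exists v => //; rewrite mxE vs mE subrr mul0r.
Qed.

Let X_cvg z : D z != 0 -> (X @ z --> X z)%classic.
Proof.
move=> D0.
have cZ v : (Zv^~ v @ z --> Zv z v)%classic.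
  apply: (@cvg_bigop R _ _ _ _ _ _
    (fun i (t : 'rV[R]_j) => t ord0 i * (e i == v)%:R)) => [f g cf cg|i _].
    exact: (cvgD cf cg).
  by apply: (cvgM (@cvg_coord _ i z)); apply: cvg_cst.
have cm : (m @ z --> m z)%classic.
  refine (@cvg_bigop R _ _ (index_enum _) (fun v => v \in s) Num.min 0
    (fun v (t : 'rV[R]_j) => Zv t v) z _ _) => [f g cf cg|v _] //.
  exact: (@continuous_min R _ f g z cf cg).
have cD : (D @ z --> D z)%classic.
  apply: (@cvg_bigop R _ _ (index_enum _) (fun v => v \in s) +%R 0
    (fun v (t : 'rV[R]_j) => Zv t v - m t)) => [f g cf cg|v _].
    exact: (cvgD cf cg).
  exact: (cvgB (cZ v) cm).
have c0 := @cvg_cst R (0 : R) _ (nbhs z) _.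
have cXv v := cvgM (cvgB (cZ v) cm) (cvgV D0 cD).
apply: cvg_row => v; rewrite mxE; under eq_fun do rewrite mxE.
by case: (v \in s); [apply: cXv | apply: c0].
Qed.

(** If both terms vanish, the coordinates on [s] are all equal and one of them is 0, so they cannot
    sum to 1. *)
Let den_gt0 x : face s x -> 0 < den x.
Proof.
case=> x0 x1 xs.
have q0 : 0 <= q x by apply: prodr_ge0.
rewrite lt0r addr_ge0 ?sqrtr_ge0 // andbT paddr_eq0 ?sqrtr_ge0 //.
apply/negP => /andP[]; rewrite sqrtr_eq0 => N0 /prodf_eq0[u us /eqP xu].
have {}N0 : N2 (y x) = 0.
  by apply/eqP; rewrite eq_le N0 /=; apply: sumr_ge0 => i _; apply: sqr_ge0.
have yE i : x ord0 (e i) = x ord0 v1.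
  have /psumr_eq0P h0 := N0; have /eqP := h0 (fun i _ => sqr_ge0 _) i isT.
  by rewrite sqrf_eq0 mxE subr_eq0 => /eqP.
have xE v : v \in s -> x ord0 v = x ord0 v1.
  by case/s_cases => [->//|[i ->]].
have /eqP : \sum_i x ord0 i = 0.
  apply: big1 => v _; have [vs|/xs//] := boolP (v \in s).
  by rewrite xE // -(xE u us).
by rewrite x1 oner_eq0.
Qed.

Let h_cvg x : den x != 0 -> (h @ x --> h x)%classic.
Proof.
move=> d0.
have cy i : ((fun t => y t ord0 i) @ x --> y x ord0 i)%classic.
  rewrite mxE; under eq_fun do rewrite mxE.
  exact: (cvgB (@cvg_coord _ (e i) x) (@cvg_coord _ v1 x)).
have cN : ((fun t => N2 (y t)) @ x --> N2 (y x))%classic.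
  apply: (@cvg_bigop R _ _ _ _ _ _ (fun i (t : E) => y t ord0 i ^+ 2)) => [f g cf cg|i _].
    exact: (cvgD cf cg).
  by rewrite expr2; under eq_fun do rewrite expr2; exact: (cvgM (cy i) (cy i)).
have cq : (q @ x --> q x)%classic.
  apply: (@cvg_bigop R _ _ _ _ _ _ (fun i (t : E) => t ord0 i)) => [f g cf cg|i _].
    exact: (cvgM cf cg).
  exact: (@cvg_coord _ i x).
have cd : (den @ x --> den x)%classic.
  have csq := @cvg_comp _ _ _ (fun t => N2 (y t)) Num.sqrt _ _ _ cN
    (@sqrt_continuous R (N2 (y x))).
  exact: (cvgD csq cq).
apply: cvg_row => i; rewrite mxE; under eq_fun do rewrite mxE.
exact: (cvgM (cvgV d0 cd) (cy i)).
Qed.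

Let N2Z a z : N2 (a *: z) = a ^+ 2 * N2 z.
Proof. by rewrite /N2 mulr_sumr; apply: eq_bigr => i _; rewrite mxE exprMn. Qed.

Let N2_ge0 z : 0 <= N2 z.
Proof. by apply: sumr_ge0 => i _; apply: sqr_ge0. Qed.

Let h_disk x : face s x -> sc_udisk R j (h x).
Proof.
move=> fx; have d0 := den_gt0 fx; case: fx => x0 _ _.
rewrite /sc_udisk -/(N2 _) /h N2Z exprVn mulrC ler_pdivrMr ?exprn_gt0 // mul1r.
rewrite -[N2 (y x)]sqr_sqrtr // lerXn2r ?nnegrE ?sqrtr_ge0 ?(ltW d0) //.
by rewrite lerDl; apply: prodr_ge0.
Qed.

Let q_boundary x : boundary s x -> q x = 0.
Proof.
case=> _ [u us xu]; apply/eqP/prodf_eq0.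
by exists u => //; rewrite xu.
Qed.

Let h_sphere x : boundary s x -> sc_usphere R j (h x).
Proof.
move=> bx; have d0 := den_gt0 bx.1; move: d0; rewrite /h /den q_boundary // addr0 => d0.
rewrite /sc_usphere -/(N2 _) N2Z exprVn sqr_sqrtr // mulVf //.
by move: d0; rewrite sqrtr_gt0 => /gt_eqF ->.
Qed.

(** With a = 1 / den x, some coordinate of x is 0, so the minimum is - a x_v1. The shifted
    coordinates are therefore a x_v, and their sum is a. *)
Let X_h x : boundary s x -> X (h x) = x.
Proof.
move=> bx; have a0 : 0 < (den x)^-1 by rewrite invr_gt0 den_gt0 //; case: bx.
case: bx => -[x0 x1 xs] [u us xu]; rewrite /h; set a := (den x)^-1 in a0 *.
have ZE v : v \in s -> Zv (a *: y x) v = a * (x ord0 v - x ord0 v1).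
  case/s_cases => [->|[i ->]]; first by rewrite Zv_v1 subrr mulr0.
  by rewrite Zv_e !mxE.
have mE : m (a *: y x) = - (a * x ord0 v1).
  apply/le_anti/andP; split.
    by have := m_le (a *: y x) us; rewrite ZE // xu sub0r mulrN.
  have [v vs ->] := m_att (a *: y x); rewrite ZE // mulrBr lerDr.
  by rewrite mulr_ge0 // ltW.
have dE v : v \in s -> Zv (a *: y x) v - m (a *: y x) = a * x ord0 v.
  by move=> vs; rewrite ZE // mE; ring.
have DE : D (a *: y x) = a.
  rewrite /D (eq_bigr _ dE) -mulr_sumr -[RHS]mulr1 -x1; congr (_ * _).
  rewrite [RHS](bigID (mem s)) /= [X in _ = _ + X]big1 ?addr0 // => v /xs.
apply/rowP => v; rewrite mxE DE; case: ifP => [vs|/negbT/xs ->//].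
by rewrite dE // mulrC mulKf // gt_eqF.
Qed.

(** Extend [r \o X] from the sphere to the ball, and precompose with [h]. *)
Lemma extend_face (r : E -> E) : sc_conn_pi R K #|s :\ v1| ->
  (forall x, boundary s x -> sc_realization R K (r x)) ->
  {within boundary s, continuous r}%classic ->
  exists g : E -> E, [/\ {within face s, continuous g}%classic,
    forall x, face s x -> sc_realization R K (g x) &
    forall x, boundary s x -> g x = r x].
Proof.
move=> conn rK rc.
have [||g [gc gK gr]] := conn (r \o X).
- apply: within_comp rc; first exact: X_boundary.
  apply: continuous_at_within => z /D_gt0 D0; apply: X_cvg.
  by rewrite gt_eqF.
- by move=> _ [z zs <-]; apply/rK/X_boundary.
exists (g \o h); split.
- apply: within_comp gc; first exact: h_disk.
  by apply: continuous_at_within => x /den_gt0 d0; apply: h_cvg; rewrite gt_eqF.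
- by move=> x fx; apply: gK; exists (h x) => //; apply: h_disk.
by move=> x bx; rewrite /= gr /= ?X_h //; apply: h_sphere.
Qed.

End Extension.

Lemma boundaryE s : boundary s =
  [set x : E | exists2 u, u \in enum s & (face (s :\ u) : set E) x]%classic.
Proof.
apply/seteqP; split=> x.
  case=> -[x0 x1 xs] [u us xu]; exists u; first by rewrite mem_enum.
  split=> // v; rewrite !inE negb_and negbK => /orP[/eqP->//|]; exact: xs.
case=> u; rewrite mem_enum => us [x0 x1 xs]; split.
  by split=> // v vs; apply: xs; rewrite !inE negb_and vs orbT.
by exists u => //; apply: xs; rewrite !inE eqxx.
Qed.

Lemma face_boundary s x : face s x -> supp x != s -> boundary s x.
Proof.
move=> fx xs; split=> //; have [ss _] := face_supp fx.
have /properP[_ [u us ux]] : supp x \proper s by rewrite properEneq xs.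
by exists u => //; move: ux; rewrite inE negbK => /eqP.
Qed.

Section Skeleton.
Variables (K : {set {set 'I_n}}) (p : nat).
Hypothesis cK : sc_is_complex K.
Hypothesis connK : forall j, (j <= p)%N -> sc_conn_pi R K j.

(** Built by increasing dimension: the identity stays on faces in [K], and each other face is filled
    from its boundary by [extend_face]. *)
Lemma skeleton_map : exists r : E -> E,
  [/\ forall s, (#|s| <= p.+1)%N -> {within face s, continuous r}%classic,
      forall s x, (#|s| <= p.+1)%N -> face s x -> sc_realization R K (r x) &
      forall x, supp x \in K -> r x = x].
Proof.
suff H : forall j, (j <= p.+1)%N -> exists r : E -> E,
  [/\ forall s, (#|s| <= j)%N -> {within face s, continuous r}%classic,
      forall s x, (#|s| <= j)%N -> face s x -> sc_realization R K (r x) &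
      forall x, (supp x \in K) || (j < #|supp x|)%N -> r x = x].
  have [r [rc rK rid]] := H _ (leqnn p.+1); exists r; split=> // x xK.
  by apply: rid; rewrite xK.
elim=> [_|j IHj jp].
  exists id; split=> // [s _|s x].
    by apply: continuous_at_within => x _; apply: cvg_id.
  rewrite leqn0 cards_eq0 => /eqP -> [_ x1 xs].
  move: x1; rewrite big1 => [/eqP|i _]; first by rewrite eq_sym oner_eq0.
  by apply: xs; rewrite inE.
have [r [rc rK rid]] := IHj (ltnW jp).
have bnd s x : #|s| = j.+1 -> boundary s x -> sc_realization R K (r x).
  move=> sj; rewrite boundaryE => -[u us]; apply: rK.
  by rewrite mem_enum in us; have := cardsD1 u s; rewrite us sj => -[->].
have step s : exists g : E -> E, #|s| = j.+1 ->
    [/\ {within face s, continuous g}%classic,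
    forall x, face s x -> sc_realization R K (g x) &
    forall x, boundary s x -> g x = r x].
  have [sj|/eqP sj] := eqVneq #|s| j.+1; last by exists id.
  have /card_gt0P[v vs] : (0 < #|s|)%N by rewrite sj.
  have sv : #|s :\ v| = j by have := cardsD1 v s; rewrite vs sj => -[].
  have [|||g gP] := @extend_face K s v vs r.
  - by apply: connK; rewrite sv -ltnS.
  - by move=> x; apply: bnd.
  - rewrite boundaryE; apply: within_bigU => u; rewrite mem_enum => us.
      exact: closed_face.
    by apply: rc; have := cardsD1 u s; rewrite us sj => -[->].
  by exists g.
have [G GP] := choice step.
(* Points whose support is a nonface with j + 1 vertices get the new value. Boundary points of such
   a face have smaller support and keep [r], with which [G] agrees there. *)
pose r' x := if (supp x \notin K) && (#|supp x| == j.+1) then G (supp x) x else r x.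
exists r'; split=> [s sj|s x sj fx|x].
- move: sj; rewrite leq_eqVlt => /orP[/eqP sj|sj]; last first.
    apply: eq_within (rc s sj) => x /face_supp[/subset_leq_card xs _].
    rewrite /r' ifF //; apply/negbTE; rewrite negb_and neq_ltn.
    by rewrite (leq_ltn_trans xs sj) orbT.
  have [sK|sK] := boolP (s \in K).
    apply: (@eq_within _ _ _ id) => [x /face_supp[xs _]|].
      by rewrite /r' (cK sK xs) /= rid // (cK sK xs).
    by apply: continuous_at_within => x _; apply: cvg_id.
  have [gc _ gr] := GP s sj.
  apply: eq_within gc => x fx; rewrite /r'.
  have [->|xs] := eqVneq (supp x) s; first by rewrite sK sj eqxx.
  rewrite gr; last exact: face_boundary.
  rewrite ifF //; apply/negbTE; rewrite negb_and neq_ltn.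
  have [ss _] := face_supp fx.
  have := proper_card (_ : supp x \proper s); rewrite properEneq xs ss sj => -> //.
  by rewrite orbT.
- rewrite /r'; have [ss fs] := face_supp fx.
  case: ifP => [/andP[_ /eqP xj]|/negbT]; first by have [_ + _] := GP _ xj; apply.
  rewrite negb_and negbK => /orP[xK|xj].
    by rewrite rid ?xK //; apply: supp_realization fx xK.
  apply: (rK (supp x)) => //; rewrite -ltnS ltn_neqAle xj.
  by apply: leq_trans sj; apply: subset_leq_card.
move=> h; rewrite /r' ifF ?rid //.
  by case/orP: h => [->//|/ltnW ->]; rewrite orbT.
apply/negbTE; rewrite negb_and negbK; case/orP: h => [->//|h].
by rewrite neq_ltn h !orbT.
Qed.

(** At level 0 the sphere is empty; the extension evaluated at the single point of the 0-disk is the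
    point sought. *)
Lemma conn_pi_vertex : exists x : E, sc_realization R K x.
Proof.
have [||g [_ gK _]] := connK (leq0n p) (f := fun=> 0).
- by apply: continuous_subspaceT => x; apply: cst_continuous.
- move=> z [x + _]; rewrite /sc_usphere /= big_ord0 => /eqP.
  by rewrite eq_sym oner_eq0.
exists (g 0); apply: gK; exists 0 => //.
by rewrite /sc_udisk big_ord0 ler01.
Qed.

Lemma conn_pi_acyc : acyc K p.
Proof.
have [x0 [_ [x01 _]]] := conn_pi_vertex.
have n_gt0 : (0 < n)%N.
  rewrite lt0n; apply/eqP => n0; move: x01; rewrite big1 => [/eqP|i _].
    by rewrite eq_sym oner_eq0.
  by have := ltn_ord i; rewrite {2}n0.
have v0 : 'I_n := Ordinal n_gt0.
have n0 : (n%:R : R) != 0 by rewrite pnatr_eq0 -lt0n.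
have nV : 0 < (n%:R^-1 : R) by rewrite invr_gt0 ltr0n.
have [r [rc rK rid]] := skeleton_map.
(* Coordinates indexed by n vertices and summing to 1 include one that is at least 1/n; [v0] is a
   formal default. *)
pose phi x := odflt v0 [pick v | n%:R^-1 <= r x ord0 v].
have phiP x : sc_realization R K (r x) -> n%:R^-1 <= r x ord0 (phi x).
  case=> r0 [r1 _]; rewrite /phi; case: pickP => //= h.
  have h' v : 0 < n%:R^-1 - r x ord0 v by rewrite subr_gt0 ltNge h.
  have : \sum_v (n%:R^-1 - r x ord0 v) = 0.
    by rewrite sumrB r1 sumr_const card_ord -[X in X - _]mulr_natr mulVf // subrr.
  move/psumr_eq0P => /(_ (fun v _ => ltW (h' v)) v0 isT) e.
  by have := h' v0; rewrite e ltxx.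
have unif s : exists d : R, 0 < d /\ ((#|s| <= p.+1)%N -> forall x y,
    face s x -> face s y -> `|x - y| < d -> `|r x - r y| < n%:R^-1).
  have [sp|_] := boolP (#|s| <= p.+1)%N; last by exists 1.
  have [d d0 dP] := compact_unif nV (@compact_face s) (rc s sp).
  by exists d; split=> // _; apply: dP.
have [d dP] := choice unif.
(* Half the minimum, because a mesh at most [delta] must be strictly below every [d s]. *)
pose delta := (\big[Num.min/1]_(s : {set 'I_n}) d s) / 2.
have min0 : 0 < \big[Num.min/1]_(s : {set 'I_n}) d s.
  elim/big_ind: _ => // [a b a0 b0|s _]; last by case: (dP s).
  by rewrite lt_min a0.
have delta_lt s : delta < d s.
  have : \big[Num.min/1]_(s : {set 'I_n}) d s <= d s by apply: bigmin_le.
  rewrite /delta; lra.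
apply: (@acyc_of_labeling R n K p v0 cK phi delta).
- by rewrite divr_gt0.
- move=> s x sK fx; have [xs _] := face_supp fx.
  have rx := rid x (cK sK xs).
  have /phiP : sc_realization R K (r x).
    by rewrite rx; apply: supp_realization fx (cK sK xs).
  rewrite rx => h; apply: (subsetP xs); rewrite inE gt_eqF //.
  exact: lt_le_trans h.
move=> s t sp; case: t => [//|x t] _ [tf tr].
have fx : face s x by apply: tf; rewrite mem_head.
have [_ [_ rxK]] := rK s x sp fx.
(* Every label lies in the support of [r x]: coordinate [phi y] is at least 1/n at [r y] and changes
   by less than 1/n. *)
apply: (cK rxK); apply/subsetP => v; rewrite [v \in lset _]inE => /mapP[y yt ->].
rewrite [_ \in supp _]inE.
have fy := tf y yt; have := phiP y (rK s y sp fy).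
have xy : `|x - y| < d s.
  by apply: le_lt_trans (delta_lt s); apply: tr => //; rewrite mem_head.
have := row_dist_coord (phi y) ((dP s).2 sp x y fx fy xy).
rewrite ltr_norml => /andP[h _] h'; rewrite gt_eqF //; lra.
Qed.

End Skeleton.

End Faces.

(** * From eta to acyclicity *)

Section Eta.
Import mathcomp.boot.fintype mathcomp.boot.finset.

(** If eta is the finite value a, then m + b < t <= a + b gives m < a, and a is the least failing
    index. *)
Lemma sc_eta_of_ge (c : nat -> Prop) b t m :
  sc_xadd_ge (sc_eta_of c) b t -> (m + b < t)%N -> c m.
Proof.
rewrite /sc_eta_of; case: pselect => [H|H _ _] /=; last first.
  by apply: contra_notP H => ncm; exists m.
case: ex_minnP => a na amin ta mt; apply: contrapT => ncm.
have /amin am : ~~ `[< c m >] by apply/negP => /asboolP.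
by lia.
Qed.

Variables (R : realType) (n : nat) (C M : {set {set 'I_n}}) (k : nat).
Variable e : sc_eta_kind.
Hypotheses (cC : sc_is_complex C) (matM : sc_is_matroid M) (k_gt0 : (0 < k)%N).
Hypothesis etaC : forall X : {set 'I_n}, sc_is_flat M (~: X) ->
  (sc_mrank (sc_mrestr M (~: X)) <= k.-1)%N ->
  sc_xadd_ge (sc_eta R e (sc_induced C X)) (sc_mrank (sc_mrestr M (~: X))) k.+1.

Lemma induced_complex X : sc_is_complex (sc_induced C X).
Proof.
move=> s t; rewrite !inE => /andP[sC sX] ts.
by rewrite (cC sC ts) (subset_trans ts sX).
Qed.

Lemma eta_flat F : sc_is_flat M F -> (rk M F < k)%N ->
  sc_xadd_ge (sc_eta R e (sc_induced C (~: F))) (rk M F) k.+1.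
Proof.
move=> flF rF; have := etaC (X := ~: F); rewrite setCK; apply=> //.
by rewrite -ltnS prednK.
Qed.

Lemma eta_acyclic : flats_acyclic M k C.
Proof.
move=> F p flF rF pF; have := eta_flat flF rF.
case: e => /= h; last first.
  by apply: conn_H_acyc; [apply: induced_complex | apply: sc_eta_of_ge h _].
(* The skeleton construction uses all levels up to [p], each of them below eta. *)
apply: (@conn_pi_acyc R) => [|j jp]; first exact: induced_complex.
by apply: sc_eta_of_ge h _; lia.
Qed.

(** The bound on eta is applied to the flat of loops, of rank 0; level 0 yields a simplex of [C],
    hence the empty one. *)
Lemma eta_set0 : set0 \in C.
Proof.
have r0 : rk M (cl M set0) = 0%N.
  rewrite rk_cl //; have [I [_ I0 <-]] := rk_basis matM set0.
  by move: I0; rewrite subset0 => /eqP ->; rewrite cards0.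
have := eta_flat (@cl_flat _ M matM set0); rewrite r0 => /(_ k_gt0).
have lt : (0 + 0 < k.+1)%N by [].
case: e => /= /sc_eta_of_ge /(_ lt) h; last first.
  by case: h => v; rewrite inE => /andP[vC _]; apply: cC vC (sub0set _).
have [|x] := @conn_pi_vertex R _ (sc_induced C (~: cl M set0)) 0.
  by move=> j; rewrite leqn0 => /eqP ->.
case=> _ [_]; rewrite [_ \in sc_induced _ _]inE => /andP[xC _].
exact: cC xC (sub0set _).
Qed.

End Eta.

Unset Implicit Arguments. Set Strict Implicit.

Theorem theorem5p2 (R : realType) (n : nat) (C M : {set {set 'I_n}}) (k : nat)
  (e : sc_eta_kind) :
  sc_is_complex C -> sc_is_matroid M ->
  (1 <= k)%N -> (k <= sc_mrank M)%N ->
  (forall X : {set 'I_n},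
     sc_is_flat M (finset.setC X) -> (sc_mrank (sc_mrestr M (finset.setC X)) <= k.-1)%N ->
     sc_xadd_ge (sc_eta R e (sc_induced C X)) (sc_mrank (sc_mrestr M (finset.setC X))) k.+1) ->
  sc_rg_connected C M k.
Proof.
move=> cC matM k_gt0 k_rk etaC.
apply: rg_connected => //; first exact: eta_set0 etaC.
exact: eta_acyclic etaC.
Qed.
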